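(* The following two problems can be solved in polynomial time: (a) given an interval graph $G$, find a minimum set $V_-\subseteq V(G)$ such that $G - V_-$ is a complete split graph; (b) given an interval graph $G$, find a minimum set $V_-\subseteq V(G)$ such that $G - V_-$ is a cluster graph.
   Context: All graphs are finite, simple and undirected. A graph is an interval graph if its vertices can be assigned intervals of the real line so that two vertices are adjacent iff their intervals intersect. A graph is a complete split graph if its vertex set can be partitioned into a clique $C$ and an independent set $I$ (either possibly empty) such that every vertex of $C$ is adjacent to every vertex of $I$. A cluster graph is a graph every connected component of which is a clique. *)

(* Defs.v *)
From mathcomp Require Import all_boot all_order all_algebra.
From mathcomp Require Import reals.

Set Implicit Arguments.
Unset Strict Implicit.
Unset Printing Implicit Defensive.

Record graph (V : finType) := Graph {
  adj :> rel V;
  adj_sym : symmetric adj;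
  adj_irr : irreflexive adj
}.

Section Graphs.
Variable V : finType.
Implicit Types (G : graph V) (X : {set V}).

Lemma delete_sym G X :
  symmetric (fun x y : {v : V | v \notin X} => adj G (val x) (val y)).
Proof. by move=> x y; apply: adj_sym. Qed.

Lemma delete_irr G X :
  irreflexive (fun x y : {v : V | v \notin X} => adj G (val x) (val y)).
Proof. by move=> x; apply: adj_irr. Qed.

(* G - X *)
Definition delete G X : graph {v : V | v \notin X} :=
  Graph (@delete_sym G X) (@delete_irr G X).

Definition clique G X : Prop :=
  forall x y, x \in X -> y \in X -> x != y -> adj G x y.

Definition independent G X : Prop :=
  forall x y, x \in X -> y \in X -> ~~ adj G x y.

(* Intervals may be open, closed, half-open or unbounded, independently of
   each other.  Adjacency is constrained on distinct vertices only, since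
   [adj] is irreflexive. *)
Definition interval_graph (R : realType) G : Prop :=
  exists J : V -> interval R,
    forall x y, x != y -> (adj G x y <-> exists z : R, z \in J x /\ z \in J y).

Definition complete_split_graph G : Prop :=
  exists C I : {set V},
    [/\ C :|: I = [set: V], [disjoint C & I], clique G C, independent G I
      & forall x y, x \in C -> y \in I -> adj G x y].

Definition cluster_graph G : Prop :=
  forall x, clique G [set y | connect (adj G) x y].

End Graphs.

Definition min_deletion_set (F : forall V : finType, graph V -> Prop)
    (V : finType) (G : graph V) (X : {set V}) : Prop :=
  F _ (delete G X) /\ forall Y : {set V}, F _ (delete G Y) -> #|X| <= #|Y|.

(* Random access machine with finitely many usable registers (those named in
   the program), an unbounded indirectly addressed memory, and unit cost per
   instruction.  As the only arithmetic is addition and truncated subtraction,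
   each step at most doubles the largest stored value (program constants
   aside), so values keep polynomially many bits over polynomially many steps,
   and polynomial time on this machine is the same as on a Turing machine. *)
Inductive instr :=
| Const of nat & nat        (* Const i c  :  r_i <- c *)
| Plus of nat & nat & nat   (* Plus i j k :  r_i <- r_j + r_k *)
| Minus of nat & nat & nat  (* Minus i j k:  r_i <- r_j - r_k *)
| Read of nat & nat         (* Read i j   :  r_i <- mem[r_j] *)
| Write of nat & nat        (* Write i j  :  mem[r_i] <- r_j *)
| Jz of nat & nat.          (* Jz i l     :  goto l if r_i = 0 *)

Definition program := seq instr.

Record state := State { pc : nat; reg : nat -> nat; memory : nat -> nat }.

Definition upd (f : nat -> nat) (a v : nat) : nat -> nat :=
  fun b => if b == a then v else f b.

Definition exec (i : instr) (s : state) : state :=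
  let: State p r m := s in
  match i with
  | Const i c => State p.+1 (upd r i c) m
  | Plus i j k => State p.+1 (upd r i (r j + r k)) m
  | Minus i j k => State p.+1 (upd r i (r j - r k)) m
  | Read i j => State p.+1 (upd r i (m (r j))) m
  | Write i j => State p.+1 r (upd m (r i) (r j))
  | Jz i l => State (if r i == 0 then l else p.+1) r m
  end.

Definition halted (P : program) (s : state) : bool := size P <= pc s.

(* A halted state is a fixed point of [step]. *)
Definition step (P : program) (s : state) : state :=
  if onth P (pc s) is Some i then exec i s else s.

(* A word w is stored as its length in mem[0], followed by its bits. *)
Definition init (w : seq bool) : state :=
  State 0 (fun=> 0)
    (fun a => if a is i.+1 then nat_of_bool (nth false w i) else size w).

Definition output (s : state) : seq bool :=
  [seq memory s i.+1 != 0 | i <- iota 0 (memory s 0)].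

Definition computes_within (P : program) (w : seq bool) (t : nat)
    (u : seq bool) : Prop :=
  let s := iter t (step P) (init w) in halted P s /\ output s = u.

(* The n * n bits of the adjacency matrix, row by row. *)
Definition encode_graph (n : nat) (G : graph 'I_n) : seq bool :=
  [seq adj G x y | x <- enum 'I_n, y <- enum 'I_n].

Definition encode_set (n : nat) (X : {set 'I_n}) : seq bool :=
  [seq x \in X | x <- enum 'I_n].

(* Promise search problem: on every input graph in the class D, find a vertex
   set X with Sol G X. *)
Definition poly_time_solvable (D : forall V : finType, graph V -> Prop)
    (Sol : forall V : finType, graph V -> {set V} -> Prop) : Prop :=
  exists (P : program) (c k : nat),
    forall (n : nat) (G : graph 'I_n), D _ G ->
      exists2 X : {set 'I_n}, Sol _ G X &
        computes_within P (encode_graph G)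
          (c * size (encode_graph G) ^ k + c) (encode_set X).

(* Main.v *)
Require Import Defs.
From mathcomp Require Import all_boot all_order all_algebra.
From mathcomp Require Import reals.
From mathcomp Require Import zify.

(* Write N[x] for closed neighbourhoods.

   (a) Let (C, I) be an optimal complete split subgraph.  If |I| >= 2, let u, v
   be the leftmost and the rightmost interval of I: then N[u] ∩ N[v] is a
   clique containing C, and each vertex of I is adjacent to all of it.  If
   |I| <= 1, then C ∪ I lies in a maximal clique, and this clique is
   N[u] ∩ N[v] for its member u with the last left end and its member v with
   the first right end.  Conversely, whenever K = N[u] ∩ N[v] is a clique, its
   union with an independent set of vertices outside K adjacent to all of K
   is a complete split graph.  So it suffices to try all pairs (u, v), with a
   maximum independent set for each.

   (b) A clique Q spans the same segment of the line as a pair (a, b), its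
   leftmost and rightmost member, whence N[x] ⊆ N[a] ∪ N[b] for x in Q.  Give
   each pair of adjacent or equal vertices the size of a maximum clique among
   the x with N[x] ⊆ N[a] ∪ N[b] as its weight, and join two pairs when they
   touch.  This is again an interval graph, and its maximum weight independent
   sets yield the maximum induced cluster graphs.

   The interval representation is used in the correctness proofs only.  Maximum
   weight independent sets are found by local ratio: take a simplicial vertex p
   of positive weight, subtract its weight from N[p], recurse, and add p when
   this keeps the set independent.

   The algorithms are written in a small language of bounded loops over arrays,
   which is compiled to the machine; a running time polynomial in the loop
   bound is then automatic. *)

Set Implicit Arguments.
Unset Strict Implicit.
Unset Printing Implicit Defensive.

(** * Polynomial bounds *)

Definition poly_bounded (T : nat -> nat) : Prop :=
  exists c k, forall n, T n <= c * n ^ k + c.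

(** The [+ 1] is for [n = 0], where [0 ^ 0 = 1] exceeds [0 ^ l] for positive [l]. *)
Lemma leq_pow_exp n k l : k <= l -> n ^ k <= n ^ l + 1.
Proof.
case: n => [|n] le_kl; last by rewrite addn1 ltnW // ltnS leq_pexp2l.
by case: k le_kl => [|k] _; rewrite addn1 // exp0n.
Qed.

Lemma poly_bounded_const c : poly_bounded (fun=> c).
Proof. by exists c, 0 => n; rewrite leq_addl. Qed.

Lemma poly_boundedD T1 T2 :
  poly_bounded T1 -> poly_bounded T2 -> poly_bounded (fun n => T1 n + T2 n).
Proof.
move=> [c1 [k1 b1]] [c2 [k2 b2]]; exists (2 * (c1 + c2)), (maxn k1 k2) => n.
have h1 := leq_pow_exp n (leq_maxl k1 k2).
have h2 := leq_pow_exp n (leq_maxr k1 k2).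
by move: (b1 n) (b2 n) h1 h2; nia.
Qed.

Lemma poly_boundedM T :
  poly_bounded T -> poly_bounded (fun n => n * T n).
Proof.
move=> [c [k b]]; exists (2 * c), k.+1 => n.
have h : n <= n ^ k.+1.
  by case: n => [|n]; rewrite ?leq0n // -{1}(expn1 n.+1) leq_pexp2l.
by move: (b n) h; rewrite expnS; nia.
Qed.

(** * Verified assembly *)

Lemma upd_eq f a v : upd f a v a = v.
Proof. by rewrite /upd eqxx. Qed.

(** Jump targets are absolute, so a block of code depends on the address where it is placed. *)
Definition code := nat -> seq instr.

Definition code_at (P : program) (s : nat) (l : seq instr) : Prop :=
  forall k i, onth l k = Some i -> onth P (s + k) = Some i.

Lemma code_at_cons P s i l :
  code_at P s (i :: l) -> onth P s = Some i /\ code_at P s.+1 l.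
Proof.
move=> h; split=> [|k j hk]; first by rewrite -[s]addn0; apply: h.
by rewrite addSnnS; apply: h.
Qed.

Lemma code_at_cat P s l1 l2 :
  code_at P s (l1 ++ l2) -> code_at P s l1 /\ code_at P (s + size l1) l2.
Proof.
elim: l1 s => [|i l1 IH] s /=; first by rewrite addn0 => h; split=> // -[].
move=> h; have [hi /IH[h1 h2]] := code_at_cons h; split.
  case=> [|k] j hk; last by rewrite -addSnnS; apply: h1.
  by rewrite addn0 hi -hk.
by rewrite -addSnnS.
Qed.

Definition reaches (P : program) (T : nat) (st st' : state) : Prop :=
  exists2 t, t <= T & iter t (step P) st = st'.

Lemma reaches_refl P T st : reaches P T st st.
Proof. by exists 0. Qed.

Lemma reaches_trans P T1 T2 T st1 st2 st3 :
  reaches P T1 st1 st2 -> reaches P T2 st2 st3 -> T1 + T2 <= T ->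
  reaches P T st1 st3.
Proof.
move=> [t1 le1 e1] [t2 le2 e2] leT; exists (t2 + t1); last by rewrite iterD e1.
by rewrite addnC (leq_trans _ leT) // leq_add.
Qed.

Lemma reaches_step P s r m i :
  onth P s = Some i -> reaches P 1 (State s r m) (exec i (State s r m)).
Proof. by move=> hi; exists 1; rewrite //= /step /= hi. Qed.

Definition assertion := (nat -> nat) -> (nat -> nat) -> Prop.

(** A Hoare triple for total correctness with a time bound: control enters at the first instruction
    and leaves just behind the last one, wherever the block sits in the program. *)
Definition spec (c : code) (T : nat) (A Q : assertion) : Prop :=
  forall P s, code_at P s (c s) -> forall r m, A r m ->
  exists r' m', reaches P T (State s r m) (State (s + size (c s)) r' m')
                /\ Q r' m'.

Lemma spec_conseq c T T' (A A' Q Q' : assertion) :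
  spec c T A Q -> T <= T' -> (forall r m, A' r m -> A r m) ->
  (forall r m, Q r m -> Q' r m) -> spec c T' A' Q'.
Proof.
move=> h leT hA hQ P s hc r m /hA/(h P s hc)[r' [m' [[t let1 e] q]]].
by exists r', m'; split; [exists t => //; apply: leq_trans leT | apply: hQ].
Qed.

Definition straight (l : seq instr) : code := fun=> l.

Definition nonjump (i : instr) : bool := if i is Jz _ _ then false else true.

Definition effect (i : instr) (rm : (nat -> nat) * (nat -> nat)) :=
  let: State _ r m := exec i (State 0 rm.1 rm.2) in (r, m).

Lemma spec_straight l T (A Q : assertion) :
  all nonjump l -> size l <= T ->
  (forall r m, A r m ->
    let: (r', m') := foldl (fun rm i => effect i rm) (r, m) l in Q r' m') ->
  spec (straight l) T A Q.
Proof.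
move=> jl leT h P s; rewrite /straight => hc r m /h {h}.
elim: l T s r m jl leT hc => [|i l IH] T s r m /=.
  by move=> _ _ _ q; exists r, m; rewrite addn0; split=> //;
    apply: reaches_refl.
move=> /andP[ji jl]; case: T => // T; rewrite ltnS => leT /code_at_cons[hi hc].
have [r1 [m1 [ee ef]]]: exists r1 m1,
    exec i (State s r m) = State s.+1 r1 m1 /\ effect i (r, m) = (r1, m1).
  by case: i ji {hi} => // *; do 2!eexists; split.
rewrite ef => /(IH T _ _ _ jl leT hc)[r' [m' [hr q]]].
exists r', m'; split=> //; rewrite -addSnnS.
by apply: (reaches_trans (reaches_step r m hi)); [rewrite ee; exact: hr|].
Qed.

Definition seqc (c1 c2 : code) : code :=
  fun s => c1 s ++ c2 (s + size (c1 s)).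

Lemma spec_seq c1 c2 T1 T2 (A M Q : assertion) :
  spec c1 T1 A M -> spec c2 T2 M Q -> spec (seqc c1 c2) (T1 + T2) A Q.
Proof.
move=> h1 h2 P s /code_at_cat[hc1 hc2] r m /(h1 P s hc1)[r1 [m1 [e1 q1]]].
have [r2 [m2 [e2 q2]]] := h2 P _ hc2 _ _ q1.
exists r2, m2; split=> //; apply: reaches_trans e1 _ (leqnn _).
by rewrite /seqc size_cat addnA.
Qed.

(** The only jumps are conditional; clearing register [d] makes the jump over the second branch
    unconditional. Hence the [upd r d 0] in [spec_branch]. *)
Definition branch (d : nat) (c1 c2 : code) : code := fun s =>
  let a := c1 s.+1 in
  let s2 := s.+3 + size a in
  let b := c2 s2 in
  Jz d s2 :: a ++ [:: Const d 0, Jz d (s2 + size b) & b].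

Lemma spec_branch d c1 c2 T1 T2 (A Q1 Q : assertion) :
  spec c1 T1 (fun r m => A r m /\ r d != 0) Q1 ->
  (forall r m, Q1 r m -> Q (upd r d 0) m) ->
  spec c2 T2 (fun r m => A r m /\ r d = 0) Q ->
  spec (branch d c1 c2) (T1 + T2 + 3) A Q.
Proof.
move=> h1 h12 h2 P s; rewrite /branch /=.
set a := c1 _; set s2 := s.+3 + size a; set b := c2 _.
move=> /code_at_cons[hj /code_at_cat[ha]].
move=> /code_at_cons[hk /code_at_cons[hl hb]] r m Arm.
have -> : s + (size (a ++ [:: Const d 0, Jz d (s2 + size b) & b])).+1
          = s2 + size b by rewrite size_cat /= /s2; lia.
have := reaches_step r m hj; rewrite /=; case: eqVneq => [rd0|rd0] hr.
  have hb' : code_at P s2 b by move: hb; congr code_at; rewrite /s2; lia.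
  have [r' [m' [e q]]] := h2 P _ hb' r m (conj Arm rd0).
  by exists r', m'; split=> //; apply: reaches_trans hr e _; lia.
have [r' [m' [e q]]] := h1 P _ ha r m (conj Arm rd0).
exists (upd r' d 0), m'; split; last exact: h12.
have hr' := reaches_trans hr e (leqnn _).
have hr2 := reaches_trans hr' (reaches_step r' m' hk) (leqnn _).
have := reaches_step (upd r' d 0) m' hl; rewrite /= upd_eq eqxx.
by move=> hr3; apply: reaches_trans hr2 hr3 _; lia.
Qed.

(** Registers are used as a stack: code compiled at depth [d] may overwrite those from [d] on and
    preserves those below. *)
Definition agree (d : nat) (r r' : nat -> nat) : Prop :=
  forall i, i < d -> r i = r' i.

Lemma agree_upd d r r' i v : d <= i -> agree d r r' -> agree d (upd r i v) r'.
Proof.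
move=> di h j jd; rewrite /upd; case: eqP => [e|_]; last exact: h.
by move: jd; rewrite e ltnNge di.
Qed.

(** Register 0 holds the bound and [d] the counter; [d.+1] holds the number of rounds left, and
    later serves for the increment and for the unconditional jump back to the test. *)
Definition loop (d : nat) (body : code) : code := fun s =>
  let b := body s.+3 in
  [:: Const d 0, Minus d.+1 0 d, Jz d.+1 (s + size b + 7) &
   b ++ [:: Const d.+1 1; Plus d d d.+1; Const d.+1 0; Jz d.+1 s.+1]].

(** A round costs 2 steps for the test and 4 for the increment and the jump back; the final 3 are
    the initialisation and the last test. The invariant must depend only on registers below [d], as
    the loop itself changes [d] and [d.+1]. *)
Lemma spec_loop d body T B (Inv : nat -> assertion) :
  0 < d ->
  (forall k r r' m, agree d r' r -> Inv k r m -> Inv k r' m) ->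
  (forall k r m, Inv k r m -> r 0 = B) ->
  (forall k, k < B -> spec body T (fun r m => Inv k r m /\ r d = k)
                                  (fun r m => Inv k.+1 r m /\ r d = k)) ->
  spec (loop d body) (B * (T + 6) + 3) (Inv 0) (Inv B).
Proof.
move=> d0 Iag IB hb P s; rewrite /loop; set b := body _.
move=> /code_at_cons[i0 /code_at_cons[i1 /code_at_cons[i2]]].
move=> /code_at_cat[hc /code_at_cons[i3 /code_at_cons[i4 /code_at_cons[i5]]]].
move=> /code_at_cons[i6 _] r m I0.
have -> : s + size [:: Const d 0, Minus d.+1 0 d, Jz d.+1 (s + size b + 7) &
   b ++ [:: Const d.+1 1; Plus d d d.+1; Const d.+1 0; Jz d.+1 s.+1]]
   = s + size b + 7 by rewrite /= size_cat /=; lia.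
(* Induction on the number [j] of rounds left, with control at the test. *)
have main : forall j k, k + j = B -> forall r m, Inv k r m -> r d = k ->
  exists r' m', reaches P (j * (T + 6) + 2) (State s.+1 r m)
    (State (s + size b + 7) r' m') /\ Inv B r' m'.
  move=> j k kB {I0 m} {}r m Ik rk.
  have rj : r 0 - r d = j by rewrite (IB _ _ _ Ik) rk; lia.
  have e := reaches_step r m i1; rewrite /= rj in e.
  have := reaches_step (upd r d.+1 j) m i2; rewrite /= upd_eq => e2.
  elim: j k kB r m Ik rk rj e e2 => [|j IH] k kB r m Ik rk rj e e2.
    have kB' : k = B by lia.
    exists (upd r d.+1 0), m; split; first exact: reaches_trans e e2 _.
    by rewrite -kB'; apply: Iag Ik; apply: agree_upd.
  set r1 := upd r d.+1 _ in e2.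
  have I1 : Inv k r1 m by apply: Iag Ik; apply: agree_upd.
  have r1d : r1 d = k by rewrite /r1 /upd; case: eqP => [|_]; [lia|].
  have kB' : k < B by lia.
  have [r2 [m2 [e3 [I2 r2d]]]] := hb k kB' P _ hc r1 m (conj I1 r1d).
  have := reaches_step r2 m2 i3 => /= e4.
  set r3 := upd r2 _ _ in e4.
  have := reaches_step r3 m2 i4 => /= e5.
  set r4 := upd r3 _ _ in e5.
  have := reaches_step r4 m2 i5 => /= e6.
  set r5 := upd r4 _ _ in e6.
  have := reaches_step r5 m2 i6 => /=.
  have -> : r5 d.+1 = 0 by rewrite /r5 upd_eq.
  rewrite eqxx => e7.
  have r5d : r5 d = k.+1.
    rewrite /r5 /r4 /r3 /upd !eqxx.
    by rewrite (_ : (d == d.+1) = false) ?r2d ?addn1 //; lia.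
  have I5 : Inv k.+1 r5 m2.
    by apply: Iag I2; rewrite /r5 /r4 /r3; do 3!apply: agree_upd => //.
  have kB2 : k.+1 + j = B by lia.
  have rj5 : r5 0 - r5 d = j by rewrite (IB _ _ _ I5) r5d; lia.
  have e8 := reaches_step r5 m2 i1; rewrite /= rj5 in e8.
  have := reaches_step (upd r5 d.+1 j) m2 i2; rewrite /= upd_eq => e9.
  have [r' [m' [e10 I']]] := IH k.+1 kB2 r5 m2 I5 r5d rj5 e8 e9.
  exists r', m'; split=> //.
  have E := reaches_trans e e2 (leqnn _).
  have {}E := reaches_trans E e3 (leqnn _).
  have {}E := reaches_trans E e4 (leqnn _).
  have {}E := reaches_trans E e5 (leqnn _).
  have {}E := reaches_trans E e6 (leqnn _).
  have {}E := reaches_trans E e7 (leqnn _).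
  by apply: reaches_trans E e10 _; lia.
have e := reaches_step r m i0; rewrite /= in e.
have I1 : Inv 0 (upd r d 0) m by apply: Iag I0; apply: agree_upd.
have [|r' [m' [e' I']]] := main B 0 (add0n _) (upd r d 0) m I1.
  by rewrite upd_eq.
by exists r', m'; split=> //; apply: reaches_trans e e' _; lia.
Qed.

(** * A language of bounded loops over arrays *)

Inductive expr :=
| Num of nat
| Var of nat
| Add of expr & expr
| Sub of expr & expr
| Get of nat & expr
| Ite of form & expr & expr
| Sum of nat & expr
with form :=
| Flt of expr & expr
| Feq of expr & expr
| Fnot of form
| Fand of form & form
| For_ of form & form
| Fex of nat & form
| Fall of nat & form.

Scheme expr_form_ind := Induction for expr Sort Prop
  with form_expr_ind := Induction for form Sort Prop.
Combined Scheme expr_form_mutind from expr_form_ind, form_expr_ind.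

Definition arrays := nat -> nat -> nat.

(* All loops run over [k < B], and arrays have length [B]: reads out of range
   give 0. *)
Fixpoint eval (B : nat) (S : arrays) (e : expr) (v : nat -> nat)
  {struct e} : nat :=
  match e with
  | Num c => c
  | Var x => v x
  | Add a b => eval B S a v + eval B S b v
  | Sub a b => eval B S a v - eval B S b v
  | Get j a => if eval B S a v < B then S j (eval B S a v) else 0
  | Ite f a b => if holds B S f v then eval B S a v else eval B S b v
  | Sum x a => \sum_(k < B) eval B S a (upd v x k)
  end
with holds (B : nat) (S : arrays) (f : form) (v : nat -> nat)
  {struct f} : bool :=
  match f with
  | Flt a b => eval B S a v < eval B S b v
  | Feq a b => eval B S a v == eval B S b v
  | Fnot f => ~~ holds B S f v
  | Fand f g => holds B S f v && holds B S g v
  | For_ f g => holds B S f v || holds B S g v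
  | Fex x f => [exists k : 'I_B, holds B S f (upd v x k)]
  | Fall x f => [forall k : 'I_B, holds B S f (upd v x k)]
  end.

Fixpoint fresh (j : nat) (e : expr) : bool :=
  match e with
  | Num _ | Var _ => true
  | Add a b | Sub a b => fresh j a && fresh j b
  | Get i a => (i != j) && fresh j a
  | Ite f a b => [&& freshf j f, fresh j a & fresh j b]
  | Sum _ a => fresh j a
  end
with freshf (j : nat) (f : form) : bool :=
  match f with
  | Flt a b | Feq a b => fresh j a && fresh j b
  | Fnot f => freshf j f
  | Fand f g | For_ f g => freshf j f && freshf j g
  | Fex _ f | Fall _ f => freshf j f
  end.

Lemma eval_fresh B j S S' :
  (forall i, i != j -> S i = S' i) ->
  (forall e, fresh j e -> forall v, eval B S e v = eval B S' e v) /\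
  (forall f, freshf j f -> forall v, holds B S f v = holds B S' f v).
Proof.
move=> eqS; apply: expr_form_mutind => //=.
- by move=> a IHa b IHb /andP[/IHa ea /IHb eb] v; rewrite ea eb.
- by move=> a IHa b IHb /andP[/IHa ea /IHb eb] v; rewrite ea eb.
- by move=> i a IHa /andP[/eqS ei /IHa ea] v; rewrite ea ei.
- by move=> f IHf a IHa b IHb /and3P[/IHf ef /IHa ea /IHb eb] v;
    rewrite ef ea eb.
- by move=> x a IHa /IHa ea v; apply: eq_bigr => k _.
- by move=> a IHa b IHb /andP[/IHa ea /IHb eb] v; rewrite ea eb.
- by move=> a IHa b IHb /andP[/IHa ea /IHb eb] v; rewrite ea eb.
- by move=> f IHf /IHf ef v; rewrite ef.
- by move=> f IHf g IHg /andP[/IHf ef /IHg eg] v; rewrite ef eg.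
- by move=> f IHf g IHg /andP[/IHf ef /IHg eg] v; rewrite ef eg.
- by move=> x f IHf /IHf ef v; apply: eq_existsb => k.
- by move=> x f IHf /IHf ef v; apply: eq_forallb => k.
Qed.

(** * Compilation of expressions and formulas *)

Definition not_code (d : nat) : code :=
  straight [:: Const d.+1 1; Minus d d.+1 d].

(* Adds [1 + j * B], with [B] in register 0. *)
Definition address (j d : nat) : code :=
  straight [:: Const d.+1 1, Plus d d d.+1 & nseq j (Plus d d 0)].

(** Register [d] accumulates, [d.+1] is both the loop counter and the bound variable, and [d.+2]
    receives the value of the body. The same code serves quantifiers: a sum of truth values is
    nonzero iff one of them is. *)
Definition sum_code (d : nat) (body : code) : code :=
  seqc (straight [:: Const d 0])
       (loop d.+1 (seqc body (straight [:: Plus d d d.+2]))).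

(* [r x] is the register holding variable [x]; the result goes to register
   [d], and a formula is true when its result is nonzero. *)
Fixpoint cexpr (e : expr) (r : nat -> nat) (d : nat) : code :=
  match e with
  | Num c => straight [:: Const d c]
  | Var x => straight [:: Const d 0; Plus d d (r x)]
  | Add a b => seqc (cexpr a r d)
      (seqc (cexpr b r d.+1) (straight [:: Plus d d d.+1]))
  | Sub a b => seqc (cexpr a r d)
      (seqc (cexpr b r d.+1) (straight [:: Minus d d d.+1]))
  | Get j a => seqc (cexpr a r d)
      (seqc (straight [:: Minus d.+1 0 d])
        (branch d.+1 (seqc (address j d) (straight [:: Read d d]))
                     (straight [:: Const d 0])))
  | Ite f a b => seqc (cform f r d.+1)
      (branch d.+1 (cexpr a r d) (cexpr b r d))
  | Sum x a => sum_code d (cexpr a (upd r x d.+1) d.+2)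
  end
with cform (f : form) (r : nat -> nat) (d : nat) : code :=
  match f with
  | Flt a b => seqc (cexpr a r d)
      (seqc (cexpr b r d.+1) (straight [:: Minus d d.+1 d]))
  | Feq a b => seqc (cexpr a r d) (seqc (cexpr b r d.+1)
      (seqc (straight [:: Minus d.+2 d d.+1; Minus d.+1 d.+1 d;
                          Plus d d.+1 d.+2])
            (not_code d)))
  | Fnot f => seqc (cform f r d) (not_code d)
  | Fand f g => seqc (seqc (cform f r d) (not_code d))
      (seqc (seqc (cform g r d.+1) (not_code d.+1))
        (seqc (straight [:: Plus d d d.+1]) (not_code d)))
  | For_ f g => seqc (cform f r d)
      (seqc (cform g r d.+1) (straight [:: Plus d d d.+1]))
  | Fex x f => sum_code d (cform f (upd r x d.+1) d.+2)
  | Fall x f => seqc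
      (sum_code d (seqc (cform f (upd r x d.+1) d.+2) (not_code d.+2)))
      (not_code d)
  end.

(** Array 0 lies exactly where the machine puts the input bits and expects the output bits; cell 0
    stays free for the length. *)
Definition stores (B : nat) (S : arrays) (m : nat -> nat) : Prop :=
  forall j i, i < B -> m (1 + i + j * B) = S j i.

(** The result is described by a predicate rather than a value, since the truth of a formula fixes
    its result only up to being zero. *)
Definition puts (c : code) (T d : nat) (r0 m0 : nat -> nat) (Q : nat -> Prop) :=
  spec c T (fun r m => agree d r r0 /\ m = m0)
           (fun r m => [/\ agree d r r0, m = m0 & Q (r d)]).

Lemma puts_impl c T T' d r0 m0 (Q Q' : nat -> Prop) :
  puts c T d r0 m0 Q -> T <= T' -> (forall v, Q v -> Q' v) ->
  puts c T' d r0 m0 Q'.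
Proof.
move=> h leT hQ; apply: (spec_conseq h) => // r m [? ? ?].
by split=> //; apply: hQ.
Qed.

Lemma puts_straight l T d r0 m0 (Q : nat -> Prop) :
  all nonjump l -> size l <= T ->
  (forall r, agree d r r0 ->
    let: (r', m') := foldl (fun rm i => effect i rm) (r, m0) l in
    [/\ agree d r' r0, m' = m0 & Q (r' d)]) ->
  puts (straight l) T d r0 m0 Q.
Proof.
by move=> hl hT h; apply: spec_straight => // r m [ag ->]; apply: h.
Qed.

Lemma agreeS d r r' v : agree d r r' -> r d = v -> agree d.+1 r (upd r' d v).
Proof.
move=> ag rd i; rewrite ltnS leq_eqVlt => /orP[/eqP->|id].
  by rewrite upd_eq.
by rewrite /upd (ltn_eqF id) ag.
Qed.

Lemma updNe f a v b : b != a -> upd f a v b = f b.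
Proof. by rewrite /upd => /negPf->. Qed.

Lemma spec_ex (V : Type) c T (A : V -> assertion) (Q : assertion) :
  (forall v, spec c T (A v) Q) -> spec c T (fun r m => exists v, A v r m) Q.
Proof. by move=> h P s hc r m [v]; apply: h. Qed.

(** The value computed by [c1] gets a name [v], so that [c2] is specified against one fixed register
    file, namely [r0] with [v] pushed at [d]. *)
Lemma puts_seq c1 c2 T1 T2 d r0 m0 (Q1 : nat -> Prop) (Q : assertion) :
  puts c1 T1 d r0 m0 Q1 ->
  (forall v, Q1 v ->
    spec c2 T2 (fun r m => agree d.+1 r (upd r0 d v) /\ m = m0) Q) ->
  spec (seqc c1 c2) (T1 + T2) (fun r m => agree d r r0 /\ m = m0) Q.
Proof.
move=> h1 h2; apply: spec_seq h1 _.
apply: (@spec_conseq _ T2 _ (fun r m => exists v,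
  Q1 v /\ (agree d.+1 r (upd r0 d v) /\ m = m0)) _ Q) => //.
  by apply: spec_ex => v P s hc r m [qv]; apply: h2.
by move=> r m [ag -> q]; exists (r d); split=> //; split=> //; apply: agreeS.
Qed.

Lemma agree_updS d r r0 v :
  agree d.+1 r (upd r0 d v) -> agree d r r0 /\ r d = v.
Proof.
move=> ag; split=> [i id|]; last by rewrite ag // upd_eq.
by rewrite ag ?(leq_trans id) // updNe // neq_ltn id.
Qed.

Lemma puts_binop c1 c2 i T1 T2 d r0 m0 (Q1 Q2 Q : nat -> Prop) op :
  puts c1 T1 d r0 m0 Q1 ->
  (forall v, puts c2 T2 d.+1 (upd r0 d v) m0 Q2) ->
  (forall r m, effect i (r, m) = (upd r d (op (r d) (r d.+1)), m)) ->
  nonjump i ->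
  (forall v w, Q1 v -> Q2 w -> Q (op v w)) ->
  puts (seqc c1 (seqc c2 (straight [:: i]))) (T1 + (T2 + 1)) d r0 m0 Q.
Proof.
move=> h1 h2 hi ni hQ; apply: puts_seq h1 _ => v qv.
apply: spec_seq (h2 v) _; apply: spec_straight; rewrite /= ?ni //.
move=> r m [/agree_updS[ag rd] -> qw].
rewrite hi; split=> //; first exact: agree_upd.
by rewrite upd_eq; apply: hQ => //; rewrite rd.
Qed.

Lemma spec_not d r0 m0 (Q Q' : nat -> Prop) :
  (forall v, Q v -> Q' (1 - v)) ->
  spec (not_code d) 2 (fun r m => [/\ agree d r r0, m = m0 & Q (r d)])
                      (fun r m => [/\ agree d r r0, m = m0 & Q' (r d)]).
Proof.
move=> hQ; apply: spec_straight => // r m [ag -> q] /=.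
split=> //; first by do 2!apply: agree_upd => //.
by rewrite !upd_eq updNe ?neq_ltn ?ltnSn //; apply: hQ.
Qed.

Lemma puts_not c T d r0 m0 (Q Q' : nat -> Prop) :
  puts c T d r0 m0 Q -> (forall v, Q v -> Q' (1 - v)) ->
  puts (seqc c (not_code d)) (T + 2) d r0 m0 Q'.
Proof. by move=> h hQ; apply: spec_seq h _; apply: spec_not. Qed.

Lemma puts_sum d body T B r0 m0 (P J : nat -> nat -> Prop) :
  0 < d -> r0 0 = B ->
  (forall k a, k < B ->
    puts body T d.+2 (upd (upd r0 d a) d.+1 k) m0 (P k)) ->
  J 0 0 -> (forall k a w, k < B -> J k a -> P k w -> J k.+1 (a + w)) ->
  puts (sum_code d body) (B * (T + 7) + 4) d r0 m0 (J B).
Proof.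
move=> d0 r00 hb J0 JS; rewrite -[4]/(3 + 1) addnA [_ + 1]addnC.
pose Inv k r m := [/\ agree d r r0, m = m0 & J k (r d)].
apply: (@spec_seq _ _ _ _ _ (Inv 0)).
  apply: spec_straight => // r m [ag ->] /=; split=> //.
    exact: agree_upd.
  by rewrite upd_eq.
rewrite -[7]/(1 + 6) addnA.
apply: (spec_loop (Inv := Inv)) => //.
- move=> k r r' m ag [ag0 -> Jk]; split=> //; last by rewrite ag.
  by move=> i id; rewrite ag ?ag0 // ltnW.
- by move=> k r m [ag _ _]; rewrite ag.
move=> k kB.
apply: (@spec_conseq _ (T + 1) _ (fun r m =>
  exists a, J k a /\ (agree d.+2 r (upd (upd r0 d a) d.+1 k) /\ m = m0)) _
   (fun r m => Inv k.+1 r m /\ r d.+1 = k)) => //; last first.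
  move=> r m [[ag -> Jk] rk]; exists (r d); split=> //; split=> //.
  by apply: agreeS => //; apply: agreeS.
apply: spec_ex => a.
apply: (@spec_conseq _ (T + 1) _ (fun r m =>
  J k a /\ (agree d.+2 r (upd (upd r0 d a) d.+1 k) /\ m = m0)) _
   (fun r m => Inv k.+1 r m /\ r d.+1 = k)) => //.
move=> Q s hc r m [Ja]; move: Q s hc r m.
apply: spec_seq (hb k a kB) _; apply: spec_straight => // r m.
move=> [/agree_updS[/agree_updS[ag ra] rk] -> Pk] /=.
split; last by rewrite updNe // neq_ltn ltnSn orbT.
split=> //; first exact: agree_upd.
by rewrite upd_eq ra; apply: JS.
Qed.

Lemma address_effect j d r m : 0 < d ->
  exists r', foldl (fun rm i => effect i rm) (r, m)
       [:: Const d.+1 1, Plus d d d.+1 & nseq j (Plus d d 0)] = (r', m)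
    /\ (forall i, i < d -> r' i = r i) /\ r' d = 1 + r d + j * r 0.
Proof.
move=> d0; pose r1 := upd (upd r d.+1 1) d (upd r d.+1 1 d + upd r d.+1 1 d.+1).
rewrite -[foldl _ _ _]/(foldl (fun rm i => effect i rm) (r1, m) _).
have r1d : r1 d = 1 + r d.
  by rewrite /r1 !upd_eq updNe ?neq_ltn ?ltnSn // addn1.
have r1i : forall i, i < d -> r1 i = r i.
  by move=> i id; rewrite /r1 !updNe // neq_ltn ?id ?(ltnW id) // ltnS ltnW.
rewrite -r1d -(r1i 0 d0) => {r1d}.
have [r2 [e [h1 h2]]]: exists r', foldl (fun rm i => effect i rm) (r1, m)
       (nseq j (Plus d d 0)) = (r', m)
    /\ (forall i, i < d -> r' i = r1 i) /\ r' d = r1 d + j * r1 0.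
  elim: j (r1) => [|j IH] r2 /=; first by exists r2; rewrite addn0.
  have [r3 [e [h1 h2]]] := IH (upd r2 d (r2 d + r2 0)).
  exists r3; split=> //; split=> [i id|].
    by rewrite h1 // updNe // neq_ltn id.
  by rewrite h2 upd_eq updNe ?neq_ltn ?d0 // mulSn addnA.
by exists r2; split=> //; split=> // i id; rewrite h1 ?r1i.
Qed.

Definition compiles_to B S v (c : (nat -> nat) -> nat -> code)
  T (Q : nat -> Prop) :=
  forall rho d r0 m0, 0 < d -> (forall x, rho x < d) -> r0 0 = B ->
    (forall x, r0 (rho x) = v x) -> stores B S m0 ->
    puts (c rho d) T d r0 m0 Q.

Lemma compiles_body B S v x k a c T Q rho d r0 m0 :
  compiles_to B S (upd v x k) c T Q ->
  0 < d -> (forall x, rho x < d) -> r0 0 = B ->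
  (forall x, r0 (rho x) = v x) -> stores B S m0 ->
  puts (c (upd rho x d.+1) d.+2) T d.+2 (upd (upd r0 d a) d.+1 k) m0 Q.
Proof.
move=> h d0 hr r00 hv hs; apply: h => //.
- move=> y; rewrite /upd; case: eqP => _ //.
  by have := hr y; lia.
- by rewrite !updNe //; lia.
move=> y; have := hr y; rewrite /upd; case: (y == x); first by rewrite eqxx.
by move=> ?; rewrite !ifN //; lia.
Qed.

Lemma compiles_second B S v c T Q rho d r0 m0 a :
  compiles_to B S v c T Q ->
  0 < d -> (forall x, rho x < d) -> r0 0 = B ->
  (forall x, r0 (rho x) = v x) -> stores B S m0 ->
  puts (c rho d.+1) T d.+1 (upd r0 d a) m0 Q.
Proof.
move=> h d0 hr r00 hv hs; apply: h => //.
- by move=> y; rewrite ltnS ltnW.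
- by rewrite updNe // neq_ltn d0.
by move=> y; rewrite updNe // neq_ltn hr.
Qed.

(** The time depends on the expression and on [B] alone. Only binders multiply it, by about [B]
    each, so for a fixed expression it is polynomial. *)
Lemma compile_correct :
  (forall e, exists2 T, poly_bounded T & forall B S v,
    compiles_to B S v (cexpr e) (T B) (eq^~ (eval B S e v)))
      /\ (forall f, exists2 T, poly_bounded T & forall B S v,
    compiles_to B S v (cform f) (T B) (fun w => (w != 0) = holds B S f v)).
Proof.
have pc := poly_bounded_const.
apply: expr_form_mutind.
- move=> c; exists (fun=> 1) => // B S v rho d r0 m0 d0 hr r00 hv hs.
  apply: puts_straight => // r ag /=; split=> //; first exact: agree_upd.
  by rewrite upd_eq.
- move=> x; exists (fun=> 2) => // B S v rho d r0 m0 d0 hr r00 hv hs.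
  apply: puts_straight => // r ag /=; split=> //.
    by do 2!apply: agree_upd => //.
  by rewrite !upd_eq updNe ?neq_ltn ?hr // ag // hv.
- move=> a [Ta pa ha] b [Tb pb hb].
  exists (fun B => Ta B + (Tb B + 1)) => [|B S v rho d r0 m0 d0 hr r00 hv hs].
    by do 2!apply: poly_boundedD => //.
  apply: (puts_binop (op := addn) (ha B S v rho d r0 m0 _ _ _ _ _)) => //.
    by move=> w; apply: compiles_second hs => //; apply: hb.
  by move=> w1 w2 /= -> ->.
- move=> a [Ta pa ha] b [Tb pb hb].
  exists (fun B => Ta B + (Tb B + 1)) => [|B S v rho d r0 m0 d0 hr r00 hv hs].
    by do 2!apply: poly_boundedD => //.
  apply: (puts_binop (op := subn) (ha B S v rho d r0 m0 _ _ _ _ _)) => //.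
    by move=> w; apply: compiles_second hs => //; apply: hb.
  by move=> w1 w2 /= -> ->.
- move=> j a [Ta pa ha].
  exists (fun B => Ta B + (1 + (j.+2 + 1 + 1 + 3))) =>
    [|B S v rho d r0 m0 d0 hr r00 hv hs].
    by apply: poly_boundedD.
  apply: puts_seq (ha B S v rho d r0 m0 _ _ _ _ _) _ => // w ew.
  (* [B - w] is nonzero exactly when the index [w] is in range. *)
  pose M r m := [/\ agree d r r0, m = m0, r d = w & r d.+1 = B - w].
  apply: (@spec_seq _ _ _ _ _ M).
    apply: spec_straight => // r m [/agree_updS[ag rd] ->] /=; split=> //.
    + exact: agree_upd.
    + by rewrite updNe // neq_ltn ltnSn.
    + by rewrite upd_eq rd ag // r00.
  apply: (@spec_branch _ _ _ _ _ _
    (fun r m => [/\ agree d r r0, m = m0 & r d = S j w /\ w < B])).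
  + apply: (@spec_seq _ _ _ _ _
      (fun r m => [/\ agree d r r0, m = m0, r d = 1 + w + j * B & w < B])).
      apply: spec_straight => [| |r m [[ag -> rd rd1] nz]].
      * by rewrite /= all_nseq orbT.
      * by rewrite /= size_nseq.
      have [r' [-> [h1 h2]]] := address_effect j r m0 d0; split=> //.
      * by move=> i id; rewrite h1 ?ag.
      * by rewrite h2 rd ag // r00.
      * by move: nz; rewrite rd1; lia.
    apply: spec_straight => // r m [ag -> rd wB] /=; split=> //.
      exact: agree_upd.
    by rewrite upd_eq rd hs.
  + move=> r m [ag -> [rd wB]]; split=> //; first exact: agree_upd.
    by rewrite updNe ?neq_ltn ?ltnSn // rd /= -ew wB.
  + apply: spec_straight => // r m [[ag -> rd rd1] z] /=; split=> //.
      exact: agree_upd.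
    by rewrite upd_eq -ew; case: ltnP => //; move: z; rewrite rd1; lia.
- move=> f [Tf pf hf] a [Ta pa ha] b [Tb pb hb].
  exists (fun B => Tf B + (Ta B + Tb B + 3)) =>
    [|B S v rho d r0 m0 d0 hr r00 hv hs].
    by do 3!apply: poly_boundedD => //.
  apply: (@spec_seq _ _ _ _ _ (fun r m =>
    [/\ agree d r r0, m = m0 & (r d.+1 != 0) = holds B S f v])).
    apply: (@spec_conseq _ (Tf B) _ (fun r m => exists w,
      agree d.+1 r (upd r0 d w) /\ m = m0) _ (fun r m =>
      [/\ agree d r r0, m = m0 & (r d.+1 != 0) = holds B S f v])) => //.
      apply: spec_ex => w.
      apply: spec_conseq (compiles_second (a :=
        w) (hf B S v) d0 hr r00 hv hs) _ _ _ => //.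
      by move=> r m [/agree_updS[ag _] -> e].
    by move=> r m [ag ->]; exists (r d); split=> //; apply: agreeS.
  apply: (@spec_branch _ _ _ _ _ _
    (fun r m => [/\ agree d r r0, m = m0 & r d = eval B S (Ite f a b) v])).
  + case hfv : (holds B S f v); last by move=> ? ? ? ? ? [[_ _ ->]].
    apply: spec_conseq (ha B S v rho d r0 m0 d0 hr r00 hv hs) _ _ _ => //.
      by move=> r m [[ag -> _] _].
    by move=> r m /=; rewrite hfv.
  + move=> r m [ag -> e]; split=> //; first exact: agree_upd.
    by rewrite updNe ?neq_ltn ?ltnSn.
  + case hfv : (holds B S f v).
      by move=> P s hc r m [[_ _ e] z]; rewrite z in e.
    apply: spec_conseq (hb B S v rho d r0 m0 d0 hr r00 hv hs) _ _ _ => //.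
      by move=> r m [[ag -> _] _].
    by move=> r m /=; rewrite hfv.
- move=> x a [Ta pa ha].
  exists (fun B => B * (Ta B + 7) + 4) => [|B S v rho d r0 m0 d0 hr r00 hv hs].
    by apply: poly_boundedD => //; apply: poly_boundedM; apply: poly_boundedD.
  pose J k w := w = \sum_(i < k) eval B S a (upd v x i).
  apply: (puts_sum (P := fun k w => w = eval B S a (upd v x k)) (J := J)) => //.
  + by move=> k w kB; apply: compiles_body hs => //; apply: ha.
  + by rewrite /J big_ord0.
  + by move=> k w w' kB; rewrite /J big_ord_recr /= => -> ->.
- move=> a [Ta pa ha] b [Tb pb hb].
  exists (fun B => Ta B + (Tb B + 1)) => [|B S v rho d r0 m0 d0 hr r00 hv hs].
    by do 2!apply: poly_boundedD => //.
  apply: (puts_binop (op := fun w1 w2 => w2 - w1)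
    (ha B S v rho d r0 m0 _ _ _ _ _)) => //.
    by move=> w; apply: compiles_second hs => //; apply: hb.
  by move=> w1 w2 /= -> ->; rewrite subn_eq0 -ltnNge.
- move=> a [Ta pa ha] b [Tb pb hb].
  exists (fun B => Ta B + (Tb B + (3 + 2))) =>
    [|B S v rho d r0 m0 d0 hr r00 hv hs].
    by do 2!apply: poly_boundedD => //.
  apply: puts_seq (ha B S v rho d r0 m0 d0 hr r00 hv hs) _ => w ew.
  apply: spec_seq (compiles_second (a := w) (hb B S v) d0 hr r00 hv hs) _.
  (* Two numbers are equal iff both truncated differences vanish, that is, iff their sum does. *)
  apply: (@spec_seq _ _ _ _ _ (fun r m => [/\ agree d r r0, m = m0 &
     r d = (eval B S b v - eval B S a v) + (eval B S a v - eval B S b v)])).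
    apply: spec_straight => // r m [/agree_updS[ag rd] -> rd1] /=; split=> //.
      by do 3!(apply: agree_upd; first by lia).
    rewrite upd_eq upd_eq (@updNe _ d.+1) ?neq_ltn ?ltnSn ?orbT // upd_eq.
    by rewrite !(@updNe _ d.+2) ?rd ?rd1 ?ew //; lia.
  apply: (@spec_not _ _ _ (eq^~ (eval B S b v - eval B S a v
    + (eval B S a v - eval B S b v))) (fun u =>
        (u != 0) = holds B S (Feq a b) v)).
  by move=> u /= ->; lia.
- move=> f [Tf pf hf].
  exists (fun B => Tf B + 2) => [|B S v rho d r0 m0 d0 hr r00 hv hs].
    exact: poly_boundedD.
  apply: puts_not (hf B S v rho d r0 m0 d0 hr r00 hv hs) _ => w /= <-.
  by case: w.
- move=> f [Tf pf hf] g [Tg pg hg].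
  exists (fun B => Tf B + 2 + (Tg B + 2 + (1 + 2))) =>
    [|B S v rho d r0 m0 d0 hr r00 hv hs].
    by do 3!apply: poly_boundedD => //; apply: poly_boundedD.
  have nf := puts_not (Q' := fun w => (w != 0) = ~~ holds B S f v)
    (hf B S v rho d r0 m0 d0 hr r00 hv hs).
  apply: puts_seq (nf _) _ => [w <-|u eu]; first by case: w.
  have ng := puts_not (Q' := fun w => (w != 0) = ~~ holds B S g v)
    (compiles_second (a := u) (hg B S v) d0 hr r00 hv hs).
  apply: spec_seq (ng _) _ => [w <-|]; first by case: w.
  (* Conjunction by De Morgan: the negations of both sides are added and the sum is negated. *)
  apply: (@spec_seq _ _ _ _ _ (fun r m => [/\ agree d r r0, m = m0 &
     (r d != 0) = ~~ (holds B S f v && holds B S g v)])).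
    apply: spec_straight => // r m [/agree_updS[ag rd] -> e] /=; split=> //.
      exact: agree_upd.
    by rewrite upd_eq addn_eq0 negb_and e rd eu negb_and.
  apply: (@spec_not _ _ _
    (fun w => (w != 0) = ~~ (holds B S f v && holds B S g v))
    (fun w => (w != 0) = holds B S (Fand f g) v)).
  by move=> w /= ew; rewrite -[RHS]negbK -ew; case: (w).
- move=> f [Tf pf hf] g [Tg pg hg].
  exists (fun B => Tf B + (Tg B + 1)) => [|B S v rho d r0 m0 d0 hr r00 hv hs].
    by do 2!apply: poly_boundedD => //.
  apply: (puts_binop (op := addn) (hf B S v rho d r0 m0 _ _ _ _ _)) => //.
    by move=> w; apply: compiles_second hs => //; apply: hg.
  by move=> w1 w2 /= <- <-; rewrite addn_eq0 negb_and.
- move=> x f [Tf pf hf].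
  exists (fun B => B * (Tf B + 7) + 4) => [|B S v rho d r0 m0 d0 hr r00 hv hs].
    by apply: poly_boundedD => //; apply: poly_boundedM; apply: poly_boundedD.
  pose J k w := (w != 0) = has (fun i => holds B S f (upd v x i)) (iota 0 k).
  apply: (@puts_impl _ (B * (Tf B + 7) + 4) _ _ _ _ (J B)) => //.
    apply: (puts_sum (P := fun k w => (w != 0) = holds B S f (upd v x k))
                     (J := J)) => //.
    + by move=> k w kB; apply: compiles_body hs => //; apply: hf.
    + move=> k w w' kB; rewrite /J -addn1 iotaD has_cat /= orbF => <- <-.
      by rewrite addn_eq0 negb_and.
  move=> w ->; apply/hasP/existsP => [[i]|[i hi]].
    by rewrite mem_iota => /andP[_ iB] hi; exists (Ordinal iB).
  by exists (val i) => //; rewrite mem_iota /= add0n.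
- move=> x f [Tf pf hf].
  exists (fun B => B * (Tf B + 2 + 7) + 4 + 2) =>
    [|B S v rho d r0 m0 d0 hr r00 hv hs].
    by do 2!apply: poly_boundedD => //; apply: poly_boundedM;
      do 2!apply: poly_boundedD => //.
  (* The loop looks for a counterexample; a final negation turns this into the universal
     statement. *)
  pose J k w := (w != 0) = has (fun i => ~~ holds B S f (upd v x i)) (iota 0 k).
  have hn: puts (sum_code d (seqc (cform f (upd rho x d.+1) d.+2)
    (not_code d.+2)))
     (B * (Tf B + 2 + 7) + 4) d r0 m0 (J B).
    apply: (puts_sum (P := fun k w => (w != 0) = ~~ holds B S f (upd v x k))
                     (J := J)) => //.
    + move=> k w kB.
      apply: (@puts_not _ _ _ _ _ (fun u => (u != 0) = holds B S f (upd v x k))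
        (fun u => (u != 0) = ~~ holds B S f (upd v x k))) => [|u <-];
          last by case: u.
      by apply: compiles_body hs => //; apply: hf.
    + move=> k w w' kB; rewrite /J -addn1 iotaD has_cat /= orbF => <- <-.
      by rewrite addn_eq0 negb_and.
  apply: puts_not hn _ => w; rewrite /J => ew.
  have -> : (1 - w != 0) = ~~ (w != 0) by case: (w).
  rewrite ew -all_predC; apply/allP/forallP => [h i|h i].
    by move/(_ (val i)): h => /=; rewrite mem_iota negbK; apply;
      rewrite /= add0n.
  by rewrite mem_iota /= negbK => iB; apply: (h (Ordinal iB)).
Qed.

(** * Commands and their compilation *)

Inductive cmd :=
| Map of nat & nat & expr
| Seq of cmd & cmd
| For of nat & cmd.

Fixpoint run (B : nat) (c : cmd) (v : nat -> nat) (S : arrays) : arrays :=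
  match c with
  | Map j x e => fun i => if i == j then fun k =>
    eval B S e (upd v x k) else S i
  | Seq c1 c2 => run B c2 v (run B c1 v S)
  | For x c => iteri B (fun k => run B c (upd v x k)) S
  end.

(* [Map] fills its array entry by entry, so its expression must not read that
   array. *)
Fixpoint wf (c : cmd) : bool :=
  match c with
  | Map j _ e => fresh j e
  | Seq c1 c2 => wf c1 && wf c2
  | For _ c => wf c
  end.

Fixpoint ccmd (c : cmd) (rho : nat -> nat) (d : nat) : code :=
  match c with
  | Map j x e =>
      loop d (seqc (cexpr e (upd rho x d) d.+1)
        (seqc (straight [:: Const d.+2 0; Plus d.+2 d.+2 d])
          (seqc (address j d.+2) (straight [:: Write d.+2 d.+1]))))
  | Seq c1 c2 => seqc (ccmd c1 rho d) (ccmd c2 rho d)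
  | For x c => loop d (ccmd c (upd rho x d) d.+1)
  end.

(** Division with remainder by [B] recovers both indices, so distinct arrays never overlap. *)
Lemma address_inj B i i' j j' : i < B -> i' < B ->
  1 + i + j * B = 1 + i' + j' * B -> i = i' /\ j = j'.
Proof.
move=> iB iB'; rewrite -!addnA => /addnI e.
have B0 : 0 < B by apply: leq_ltn_trans iB.
have ej : j = j'.
  have := congr1 (divn^~ B) e.
  by rewrite ![_ + _ * B]addnC !divnMDl // !divn_small // !addn0.
by split=> //; move: e; rewrite ej => /addIn.
Qed.

Lemma ccmd_correct c : wf c -> exists2 T, poly_bounded T &
  forall B S v rho d r0, 0 < d -> (forall x, rho x < d) -> r0 0 = B ->
    (forall x, r0 (rho x) = v x) ->
    spec (ccmd c rho d) (T B)
      (fun r m => agree d r r0 /\ stores B S m)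
      (fun r m => agree d r r0 /\ stores B (run B c v S) m).
Proof.
have envS : forall x k d (rho v r0 : nat -> nat), (forall x, rho x < d) ->
    (forall x, r0 (rho x) = v x) ->
    (forall y, upd rho x d y < d.+1) /\
    (forall y, upd r0 d k (upd rho x d y) = upd v x k y).
  move=> x k d rho v r0 hr hv; split=> y; rewrite /upd.
    by case: eqP => // _; rewrite ltnS ltnW.
  by case: (y == x); rewrite ?eqxx // ltn_eqF ?hr.
elim: c => [j x e|c1 IH1 c2 IH2|x c IH] /=.
- move=> frj; have [T pT hT] := compile_correct.1 e.
  exists (fun B => B * (T B + (2 + (j.+2 + 1)) + 6) + 3) =>
    [|B S v rho d r0 d0 hr r00 hv].
    apply: poly_boundedD; last exact: poly_bounded_const.
    apply: poly_boundedM; do 2!(apply: poly_boundedD;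
      last exact: poly_bounded_const).
    exact: pT.
  (* The arrays when the first [k] entries of array [j] are rewritten. As [e] does not read array
     [j], its value in [Sk k] is its value in [S]. *)
  pose Sk k : arrays := fun i => if i == j
     then fun a => if a < k then eval B S e (upd v x a) else S i a else S i.
  have eqSk : forall k i, i != j -> Sk k i = S i.
    by move=> k i ij; rewrite /Sk (negPf ij).
  pose Inv k r m := agree d r r0 /\ stores B (Sk k) m.
  apply: (@spec_conseq _ (B * (T B + (2 + (j.+2 + 1)) + 6) + 3) _ (Inv 0)
    _ (Inv B)) => //.
  + apply: spec_loop => //.
    * move=> k r r' m ag [ag0 st]; split=> // i id; by rewrite ag ?ag0.
    * by move=> k r m [ag _]; rewrite ag.
    move=> k kB.
    apply: (@spec_conseq _ (T B + (2 + (j.+2 + 1))) _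
      (fun r m => exists m0, stores B (Sk k) m0 /\
         (agree d.+1 r (upd r0 d k) /\ m = m0)) _
      (fun r m => Inv k.+1 r m /\ r d = k)) => //; last first.
      by move=> r m [[ag st] rd]; exists m; split=> //; split=> //;
        apply: agreeS.
    apply: spec_ex => m0 P s hc r m [st]; move: P s hc r m.
    have [hr' hv'] := envS x k d rho v r0 hr hv.
    have r00' : upd r0 d k 0 = B by rewrite updNe // neq_ltn d0.
    apply: (@puts_seq _ _ _ _ _ _ _ _ _
      (hT B (Sk k) (upd v x k) _ _ _ _ (ltn0Sn d) hr' r00' hv' st)) => w ew.
    apply: (@spec_seq _ _ _ _ _ (fun r m =>
      [/\ agree d.+2 r (upd (upd r0 d k) d.+1 w), m = m0 & r d.+2 = k])).
      apply: spec_straight => // r m [ag ->] /=; split=> //.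
        by do 2!apply: agree_upd => //.
      have [/agree_updS[_ rk] _] := agree_updS ag.
      by rewrite !upd_eq add0n updNe ?rk //; lia.
    apply: (@spec_seq _ _ _ _ _ (fun r m =>
      [/\ agree d.+2 r (upd (upd r0 d k) d.+1 w), m = m0
        & r d.+2 = 1 + k + j * B])).
      apply: spec_straight => [| |r m [ag -> rd]].
      * by rewrite /= all_nseq orbT.
      * by rewrite /= size_nseq.
      have [r' [-> [h1 h2]]] := address_effect j r m0 (ltn0Sn d.+1); split=> //.
      * by move=> i id; rewrite h1 ?ag.
      * by rewrite h2 rd ag // !updNe ?r00 //; lia.
    apply: spec_straight => // r m [/agree_updS[/agree_updS[ag rk] rw] -> ra]
      /=.
    split=> //; split=> // i a aB; rewrite ra rw /upd.
    case: (altP (1 + a + i * B =P 1 + k + j * B)) => [eqa|neqa].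
      have [-> ->] := address_inj aB kB eqa.
      rewrite /Sk eqxx ltnSn ew.
      have [-> //] := @eval_fresh B j (Sk k) S (fun i ij => eqSk k i ij).
    rewrite st //; rewrite /Sk; case: (i =P j) => // eij.
    rewrite ltnS [a <= k]leq_eqVlt; case: (a =P k) => // eak.
    by move: neqa; rewrite eij eak eqxx.
  + move=> r m [ag st]; split=> // i a aB; rewrite st // /Sk.
    by case: (i == j).
  + move=> r m [ag st]; split=> // i a aB; rewrite st // /Sk.
    by case: (i == j); rewrite ?aB.
- move=> /andP[/IH1[T1 p1 h1] /IH2[T2 p2 h2]].
  exists (fun B => T1 B + T2 B) => [|B S v rho d r0 d0 hr r00 hv].
    exact: poly_boundedD.
  by apply: spec_seq (h1 B S v _ _ _ _ _ _ _) (h2 B _ v _ _ _ _ _ _ _).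
- move=> /IH[T pT hT].
  exists (fun B => B * (T B + 6) + 3) => [|B S v rho d r0 d0 hr r00 hv].
    apply: poly_boundedD; last exact: poly_bounded_const.
    by apply: poly_boundedM; apply: poly_boundedD pT (poly_bounded_const _).
  pose Inv k r m := agree d r r0 /\
    stores B (iteri k (fun k => run B c (upd v x k)) S) m.
  apply: (spec_loop (Inv := Inv)) => //.
  + by move=> k r r' m ag [ag0 st]; split=> // i id; rewrite ag ?ag0.
  + by move=> k r m [ag _]; rewrite ag.
  move=> k kB; have [hr' hv'] := envS x k d rho v r0 hr hv.
  have r00' : upd r0 d k 0 = B by rewrite updNe // neq_ltn d0.
  have h := hT B (iteri k (fun k => run B c (upd v x k)) S) _ _ _ _
              (ltn0Sn d) hr' r00' hv'.
  apply: (spec_conseq h) => // r m.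
    by move=> [[ag st] rk]; split=> //; apply: agreeS.
  by move=> [/agree_updS[ag rk] st].
Qed.

(** * From a command to a polynomial time program *)

Definition initial (w : seq bool) : arrays :=
  fun j i => if j == 0 then nat_of_bool (nth false w i) else 0.

(* For an input of length [n * n], the number of [x] with [x * x < n * n]. *)
Definition side_expr : expr :=
  Sum 0 (Ite (Flt (Sum 1 (Ite (Flt (Var 1) (Var 0)) (Var 0) (Num 0))) (Var 2))
             (Num 1) (Num 0)).

Lemma sum_ord_lt B k c : k <= B -> \sum_(x < B) (if x < k then c else 0)
  = k * c.
Proof.
move=> kB; rewrite -big_mkcond /= (big_ord_narrow kB) /=.
by rewrite sum_nat_const card_ord.
Qed.

Lemma side_exprP n S v : v 2 = n * n -> eval (n * n) S side_expr v = n.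
Proof.
move=> v2 /=; rewrite (eq_bigr (fun x : 'I_(n * n) => if x < n then 1 else 0)).
  by rewrite sum_ord_lt ?muln1 //; nia.
move=> x _.
(* The inner sum adds [x] once for each [y < x], which makes [x * x] without multiplication. *)
rewrite (eq_bigr (fun y : 'I_(n * n) => if y < x then val x else 0)) => [|y _].
  rewrite sum_ord_lt ?(ltnW (ltn_ord x)) //.
  rewrite /upd /= v2; congr (if _ then _ else _).
  by apply/idP/idP; nia.
by rewrite /upd /=.
Qed.

(** The program loads the word length [n * n] into register 0 as loop bound, runs the command, and
    stores [n] in cell 0 as output length. Free variables are all mapped to register 0, so they
    denote [n * n]. *)
Lemma poly_time_by_cmd (D : forall V : finType, graph V -> Prop)
    (Sol : forall V : finType, graph V -> {set V} -> Prop) (c : cmd) :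
  wf c ->
  (forall n (G : graph 'I_n), D _ G -> exists2 X, Sol _ G X &
    forall x : 'I_n,
      (run (n * n) c (fun=> n * n) (initial (encode_graph G)) 0 x != 0)
      = (x \in X)) ->
  poly_time_solvable D Sol.
Proof.
move=> wfc hc.
have [Tc pc cc] := ccmd_correct wfc.
have [Te pe ce] := compile_correct.1 side_expr.
pose rho (_ : nat) := 0.
pose prog := seqc (straight [:: Read 0 0]) (seqc (ccmd c rho 1)
  (seqc (cexpr side_expr rho 1) (straight [:: Const 2 0; Write 2 1]))).
have : poly_bounded (fun n => 1 + (Tc n + (Te n + 2))).
  have pcst := poly_bounded_const.
  by apply: poly_boundedD => //; apply: poly_boundedD => //;
    apply: poly_boundedD.
move=> [a [k hT]].
exists (prog 0), a, k => n G /hc[X SolX hX]; exists X => //.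
set w := encode_graph G.
have sw : size w = n * n by rewrite /w size_allpairs size_enum_ord.
pose Q (r m : nat -> nat) := m 0 = n /\
  forall x : 'I_n, (m x.+1 != 0) = (x \in X).
have sp : spec prog (1 + (Tc (n * n) + (Te (n * n) + 2)))
    (fun r m => r = (fun=> 0) /\ m = memory (init w)) Q.
  apply: (@spec_seq _ _ _ _ _
    (fun r m => agree 1 r (fun=> n * n) /\ stores (n * n) (initial w) m)).
    apply: spec_straight => // r m [-> ->] /=; split.
      by case=> // _; rewrite upd_eq sw.
    move=> j i iB /=; rewrite /initial; case: j => [|j] /=;
      first by rewrite addn0.
    by rewrite nth_default // sw mulSn; lia.
  apply: spec_seq (cc _ _ (fun=> n * n) _ _ _ _ _ _ _) _ => //.
  apply: (@spec_conseq _ (Te (n * n) + 2) _ (fun r m => exists m0,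
      stores (n * n) (run (n * n) c (fun=> n * n) (initial w)) m0 /\
      (agree 1 r (fun=> n * n) /\ m = m0)) _ Q) => //; last first.
    by move=> r m [ag st]; exists m.
  apply: spec_ex => m0 P s hcode r m [st]; move: P s hcode r m.
  apply: puts_seq (ce _ _ (fun=> n * n) _ _ _ _ _ _ _ _ st) _ => // u.
  rewrite side_exprP // => eu.
  apply: spec_straight => // r m [/agree_updS[_ r1] ->] /=.
  rewrite /Q /upd /= r1 eu; split=> // x.
  have xB : x < n * n by apply: leq_trans (ltn_ord x) _; nia.
  by rewrite -hX -(st 0 x xB) mul0n addn0.
have hcode : code_at (prog 0) 0 (prog 0) by [].
have [r' [m' [[t let1 e] [q0 qX]]]] := sp (prog 0)
  0 hcode _ _ (conj erefl erefl).
have := leq_trans let1 (hT _); rewrite -/w -sw => /subnK <-.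
rewrite /computes_within iterD -[init w]/(State 0 (fun=> 0) (memory (init w)))
  e.
(* [computes_within] prescribes the exact number of steps; the surplus ones are spent in the halted
   state. *)
have stay : forall j, iter j (step (prog 0)) (State (0 + size (prog 0)) r' m')
   = State (0 + size (prog 0)) r' m'.
  elim=> //= j ->; rewrite /step /= add0n.
  by rewrite onth_default.
rewrite stay; split; first by rewrite /halted /= add0n.
rewrite /output /= q0 /encode_set.
apply: (@eq_from_nth _ false); first by rewrite size_map size_iota size_map
  size_enum_ord.
move=> i; rewrite size_map size_iota => iN.
rewrite (nth_map 0) ?size_iota // nth_iota // add0n.
rewrite (nth_map (Ordinal iN)) ?size_enum_ord // -qX.
by rewrite -[i]/(val (Ordinal iN)) nth_ord_enum.
Qed.

(** * Interval graphs *)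

Definition adjc (V : finType) (G : graph V) (x y : V) : bool :=
  (x == y) || adj G x y.

Lemma adjc_sym (V : finType) (G : graph V) : symmetric (adjc G).
Proof. by move=> x y; rewrite /adjc eq_sym adj_sym. Qed.

Section IntervalModel.
Import Order.TTheory GRing.Theory Num.Theory.
Local Open Scope ring_scope.

(** An inner point separates the two bounds strictly. Conversely, depending on the kinds of the
    ends, a closed end, the midpoint, or an end shifted by 1 lies inside. *)
Lemma interval_inhabited (R : realType) (i : interval R) :
  (exists z, z \in i) <-> let: Interval a b := i in (a < b)%O.
Proof.
case: i => a b; split=> [[z]|].
  rewrite itv_boundlr => /andP[az zb].
  by apply: le_lt_trans az (lt_le_trans _ zb); rewrite bnd_simp.
case: a b => [[] x|[]] [[] y|[]] //= h.
- exists x; move: h; rewrite bnd_simp in_itv /= lexx => ->//.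
- by exists x; move: h; rewrite bnd_simp in_itv /= lexx.
- by exists x; rewrite in_itv /= lexx.
- move: h; rewrite bnd_simp => h; exists ((x + y) / 2%:R).
  by rewrite in_itv /= !midf_lt.
- move: h; rewrite bnd_simp => h; exists y.
  by rewrite in_itv /= h lexx.
- by exists (x + 1); rewrite in_itv /= ltrDl ltr01.
- by exists (y - 1); rewrite in_itv /= ltrBlDr ltrDl ltr01.
- by exists (y - 1); rewrite in_itv /= lerBlDr lerDl ler01.
- by exists 0; rewrite in_itv.
Qed.

(** With nonempty half-open intervals between natural numbers, all later arguments about intervals
    are linear arithmetic, and the kinds of the original ends are forgotten. *)
Lemma interval_model (R : realType) (V : finType) (G : graph V) :
  interval_graph R G -> exists l r : V -> nat,
    (forall x, (l x < r x)%N) /\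
    (forall x y, adjc G x y = (l x < r y)%N && (l y < r x)%N).
Proof.
move=> [J hJ].
pose lo x := let: Interval a _ := J x in a.
pose hi x := let: Interval _ b := J x in b.
have hadj : forall x y, x != y -> adj G x y =
    [&& (lo x < hi x)%O, (lo y < hi y)%O, (lo x < hi y)%O & (lo y < hi x)%O].
  move=> x y xy.
  (* The intersection of two intervals runs from the larger lower bound to the smaller upper
     bound. *)
  have -> : [&& (lo x < hi x)%O, (lo y < hi y)%O,
    (lo x < hi y)%O & (lo y < hi x)%O]
       = (Order.max (lo x) (lo y) < Order.min (hi x) (hi y))%O.
    rewrite lt_min !gt_max.
    by do 4!case: (_ < _)%O.
  apply/idP/idP.
    move=> /(hJ x y xy)[z [zx zy]].
    have := (interval_inhabited (Interval (Order.max (lo x) (lo y))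
      (Order.min (hi x) (hi y)))).1.
    apply; exists z; rewrite itv_boundlr ge_max le_min.
    move: zx zy; rewrite /lo /hi; case: (J x) => a b; case: (J y) => a' b'.
    by rewrite !itv_boundlr => /andP[-> ->] /andP[-> ->].
  move=> h; apply/(hJ x y xy).
  have [z] := (interval_inhabited (Interval (Order.max (lo x) (lo y))
    (Order.min (hi x) (hi y)))).2 h.
  rewrite itv_boundlr ge_max le_min => /andP[/andP[h1 h2] /andP[h3 h4]].
  exists z; move: h1 h2 h3 h4; rewrite /lo /hi; case: (J x) => a b;
    case: (J y) => a' b'.
  by rewrite !itv_boundlr => -> -> -> ->.
(* Replace a bound by the number of left bounds below it; vertices with an
   empty interval are isolated, and go to private places on the right. *)
pose ne x := (lo x < hi x)%O.
pose L (b : itv_bound R) := #|[set z | (lo z < b)%O]|.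
(* Counting keeps each comparison of a left bound with any bound: if [lo y < b], then [y] itself is
   counted in [L b] but not in [L (lo y)]. *)
have LE : forall y b, (L (lo y) < L b)%N = (lo y < b)%O.
  move=> y b; case: ltP => h.
    apply: proper_card; rewrite properE; apply/andP; split.
      by apply/subsetP => z; rewrite !inE => /lt_trans; apply.
    by apply/subsetPn; exists y; rewrite !inE ?ltxx.
  apply/negbTE; rewrite -leqNgt; apply: subset_leq_card.
  by apply/subsetP => z; rewrite !inE => /lt_le_trans; apply.
have Lmax : forall b, (L b <= #|V|)%N by move=> b; apply: max_card.
exists (fun x => if ne x then L (lo x) else (#|V| + enum_rank x)%N).
exists (fun x => if ne x then L (hi x) else (#|V| + enum_rank x).+1%N).
split=> [x|x y]; first by case: ifP => h; rewrite ?LE.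
rewrite /adjc; case: eqVneq => [->|xy] /=.
  by case: ifP => h; rewrite ?LE ?ltnSn // -/(ne y) h.
rewrite hadj // -/(ne x) -/(ne y).
case: ifP => hx; case: ifP => hy; rewrite ?LE //=.
- by apply/esym/negbTE; rewrite negb_and -!leqNgt (leq_trans (Lmax _))
    ?orbT // leq_addr.
- by apply/esym/negbTE; rewrite negb_and -!leqNgt (leq_trans (Lmax _))
    // leq_addr.
- rewrite !ltnS !leq_add2l -eqn_leq; apply/esym/negbTE.
  by apply: contra xy => /eqP/val_inj/enum_rank_inj->.
Qed.

End IntervalModel.

(** * Optimal complete split and cluster subgraphs in an interval model *)

Section Model.
Variables (V : finType) (l r : V -> nat).
Hypothesis lr : forall x, l x < r x.
Let g (x y : V) := (l x < r y) && (l y < r x).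

(** Enlarge [K] to a maximal clique [M] inside [S], and take [u] in [M] with the last left end, [v]
    in [M] with the first right end. An interval meeting [u] ends after every member of [M] starts,
    and one meeting [v] starts before every member ends; so it meets all of [M] and belongs to it by
    maximality. The set [S] is needed for clusters, where only some vertices are eligible. *)
Lemma maximal_clique_pair (S K : {set V}) :
  K \subset S -> K != set0 -> {in K &, forall x y, g x y} ->
  exists u v, let D := [set x in S | g x u && g x v] in
    K \subset D /\ {in D &, forall x y, g x y}.
Proof.
move=> KS /set0Pn[x0 x0K] clK.
pose P (A : {set V}) := (A \subset S) && [forall x in A, forall y in A, g x y].
have PK : P K.
  by rewrite /P KS; apply/forall_inP => x xK; apply/forall_inP => y yK;
    apply: clK.
have [M /maxsetP[/andP[MS /forall_inP clM] maxM] KM] := maxset_exists PK.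
have {}clM : {in M &, forall x y, g x y}.
  by move=> x y xM yM; apply: (forall_inP (clM x xM)).
have x0M := subsetP KM _ x0K.
case: (arg_maxnP l x0M) => u uM maxu; case: (arg_minnP r x0M) => v vM minv.
exists u, v; set D := [set x in S | _].
have MD : M \subset D.
  by apply/subsetP => x xM; rewrite inE (subsetP MS) // !clM.
have -> : D = M; last by [].
apply/eqP; rewrite eqEsubset MD andbT; apply/subsetP => x.
rewrite inE => /and3P[xS /andP[xu ux] /andP[xv vx]].
rewrite -(maxM (x |: M)) ?setU11 ?subsetUr //.
have xg : forall y, y \in M -> g x y /\ g y x.
  move=> y yM; rewrite /g; have /= := maxu y yM; have /= := minv y yM; lia.
rewrite /P subUset sub1set xS MS /=.
apply/forall_inP => y /setU1P[->|yM]; apply/forall_inP => z /setU1P[->|zM].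
- by rewrite /g !lr.
- by have [] := xg z zM.
- by have [] := xg y yM.
- exact: clM.
Qed.

Lemma split_optimal (C I : {set V}) :
  {in C &, forall x y, g x y} ->
  {in I &, forall x y, x != y -> ~~ g x y} ->
  (forall x y, x \in C -> y \in I -> g x y) ->
  C :|: I != set0 ->
  exists u v, let D := [set x | g x u && g x v] in
    {in D &, forall x y, g x y} /\
    exists2 I0 : {set V}, {in I0 &, forall x y, x != y -> ~~ g x y} &
      (forall x, x \in I0 -> x \notin D /\ forall y, y \in D -> g x y) /\
      #|C :|: I| <= #|D| + #|I0|.
Proof.
move=> clC inI CI ne0; case: (leqP #|I| 1) => cI.
  have cl : {in C :|: I &, forall x y, g x y}.
    move=> x y /setUP[xC|xI] /setUP[yC|yI]; [exact: clC|exact: CI| |].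
      by rewrite /g andbC; apply: CI.
    have -> : x = y by apply: (card_le1_eqP cI).
    by rewrite /g !lr.
  have [u [v [KD clD]]] := maximal_clique_pair (subsetT _) ne0 cl.
  have eD : [set x in [set: V] | g x u && g x v] = [set x | g x u && g x v].
    by apply/setP => x; rewrite !inE.
  exists u, v; split; first by rewrite -eD.
  exists set0; first by move=> x y; rewrite inE.
  by split=> [x|]; rewrite ?inE // cards0 addn0 -eD subset_leq_card.
have [x1 [x2 [x1I x2I x12]]] := card_gt1P cI.
case: (arg_minnP r x1I) => u uI minu; case: (arg_maxnP l x1I) => v vI maxv.
(* Otherwise every interval of [I] would contain that of [u], while at least one of [x1], [x2]
   differs from [u]. *)
have uv : u != v.
  apply: contraNneq (inI _ _ x1I x2I x12) => euv.
  have := inI _ _ x1I uI; have := inI _ _ x2I uI.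
  have /= := minu _ x1I; have /= := minu _ x2I.
  have /= := maxv _ x1I; have /= := maxv _ x2I.
  rewrite /g -euv; have := lr u; have := lr x1; have := lr x2.
  by case: (x1 =P u) => [->|_]; case: (x2 =P u) => [->|_] //=; lia.
have gap : r u <= l v.
  have := inI _ _ uI vI uv; have /= := minu _ vI; rewrite /g.
  have := lr u; lia.
exists u, v; set D := [set x | _].
(* As [u] ends before [v] starts, the members of [D] are the intervals that span the gap between
   them. They meet each other, and they meet each interval of [I], which ends no earlier than [u]
   and starts no later than [v]. *)
have memD : forall x, (x \in D) = (l x < r u) && (l v < r x).
  move=> x; rewrite inE /g; have := lr u; have := lr v; have := lr x; lia.
split; first by move=> x y; rewrite !memD /g; lia.
exists I => //; split=> [y yI|].
  have /= := minu _ yI; have /= := maxv _ yI => h1 h2; split; last first.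
    by move=> x; rewrite memD /g; lia.
  rewrite inE negb_and; case: (y =P u) => [->|/eqP yu].
    by rewrite (inI u v) ?orbT.
  by rewrite (inI y u).
apply: leq_trans (leq_card_setU C I) _; rewrite leq_add2r subset_leq_card //.
by apply/subsetP => x xC; rewrite inE !CI.
Qed.

(** If the two intervals of each pair meet, their unions are intervals, and touching means that
    these unions intersect. *)
Definition touches (p q : V * V) : bool :=
  [|| g p.1 q.1, g p.1 q.2, g p.2 q.1 | g p.2 q.2].

(** Transitivity makes [g] an equivalence on [K]. Each class is sent to the pair of its member with
    the first left end and its member with the last right end; [J] is the set of these pairs and [F]
    gives the fibres. Two pairs that touch come from one class, by transitivity. *)
Lemma cluster_optimal (K : {set V}) :
  (forall x y z, x \in K -> y \in K -> z \in K -> g x y -> g y z -> g x z) ->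
  exists (J : {set V * V}) (F : V * V -> {set V}),
    [/\ {in J, forall p, g p.1 p.2},
        {in J &, forall p q, p != q -> ~~ touches p q},
        {in J, forall p, [/\ F p != set0, {in F p &, forall x y, g x y} &
          forall x y, x \in F p -> g x y -> g y p.1 || g y p.2]} &
        #|K| <= \sum_(p in J) #|F p|].
Proof.
move=> trK; have [->|/set0Pn[x0 _]] := eqVneq K set0.
  by exists set0, (fun=> set0); split=> [p|p q|p|]; rewrite ?inE // cards0.
have gS : forall x y, g x y -> g y x by move=> x y; rewrite /g andbC.
have gR : forall x, g x x by move=> x; rewrite /g !lr.
pose c x := [set y in K | g x y].
(* [x0] is only a default value: [lft] and [rgt] are applied to classes of elements of [K], which
   are nonempty. *)
pose lft (A : {set V}) := odflt x0 [pick y in A | [forall z in A, l y <= l z]].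
pose rgt (A : {set V}) := odflt x0 [pick y in A | [forall z in A, r z <= r y]].
have lftP : forall (A : {set V}) x, x \in A -> lft A \in A /\ {in A, forall z,
  l (lft A) <= l z}.
  move=> A x xA; rewrite /lft; case: pickP =>
    [y /andP[yA /forall_inP]|none] //=.
  case: (arg_minnP l xA) => y yA miny; have := none y;
    rewrite (yA : y \in A) /=.
  by move=> /negbT/negP[]; apply/forall_inP => z; apply: miny.
have rgtP : forall (A : {set V}) x, x \in A -> rgt A \in A /\ {in A, forall z,
  r z <= r (rgt A)}.
  move=> A x xA; rewrite /rgt; case: pickP =>
    [y /andP[yA /forall_inP]|none] //=.
  case: (arg_maxnP r xA) => y yA maxy; have := none y;
    rewrite (yA : y \in A) /=.
  by move=> /negbT/negP[]; apply/forall_inP => z; apply: maxy.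
have cx : forall x, x \in K -> x \in c x by move=> x xK; rewrite inE xK gR.
have ceq : forall x y, x \in K -> y \in K -> g x y -> c x = c y.
  move=> x y xK yK xy; apply/setP => z; rewrite !inE; case zK: (z \in K) => //=.
  by apply/idP/idP; [apply: trK (gS _ _ xy)|apply: trK xy].
have cP : forall x y, y \in c x -> y \in K /\ g x y.
  by move=> x y; rewrite inE => /andP[].
pose f x := (lft (c x), rgt (c x)).
have fE : forall x, x \in K -> [/\ (f x).1 \in K, (f x).2 \in K,
  g x (f x).1 & g x (f x).2].
  move=> x xK; have [/cP[] ? ? _] := lftP _ _ (cx x xK).
  by have [/cP[] ? ? _] := rgtP _ _ (cx x xK).
(* Both vertices meet the common first component, which lies in [K]. *)
have finj : forall x y, x \in K -> y \in K -> f x = f y -> g x y.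
  move=> x y xK yK e; have [h1 _ h2 _] := fE x xK; have [_ _ h3 _] := fE y yK.
  by apply: trK h2 _ => //; apply: gS; rewrite e.
exists (f @: K), (fun p => [set x in K | f x == p]); split.
- move=> p /imsetP[x xK ->]; have [h1 h2 h3 h4] := fE x xK.
  exact: (trK _ x) (gS _ _ h3) h4.
- move=> p q /imsetP[x xK ->] /imsetP[y yK ->]; apply: contra => t.
  have [h1 h2 h3 h4] := fE x xK; have [h1' h2' h3' h4'] := fE y yK.
  suff xy : g x y by rewrite /f (ceq x y).
  case/or4P: t => t.
  + exact: (trK _ _ _ xK h1' yK (trK _ _ _ xK h1 h1' h3 t) (gS _ _ h3')).
  + exact: (trK _ _ _ xK h2' yK (trK _ _ _ xK h1 h2' h3 t) (gS _ _ h4')).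
  + exact: (trK _ _ _ xK h1' yK (trK _ _ _ xK h2 h1' h4 t) (gS _ _ h3')).
  + exact: (trK _ _ _ xK h2' yK (trK _ _ _ xK h2 h2' h4 t) (gS _ _ h4')).
- move=> p /imsetP[x xK ->]; split.
  + by apply/set0Pn; exists x; rewrite inE xK eqxx.
  + move=> y z; rewrite !inE => /andP[yK /eqP ey] /andP[zK /eqP ez].
    by apply: finj; rewrite // ey ez.
  (* The two intervals of the pair meet and reach from the leftmost to the rightmost end of the
     class. Their union therefore contains the interval of [y], so any [z] meeting [y] meets one of
     them. *)
  move=> y z; rewrite inE => /andP[yK /eqP<-] yz.
  have [_ /(_ _ (cx y yK)) h1] := lftP _ _ (cx y yK).
  have [_ /(_ _ (cx y yK)) h2] := rgtP _ _ (cx y yK).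
  have [h3 h4 h5 h6] := fE y yK; have := trK _ _ _ h3 yK h4 (gS _ _ h5) h6.
  by move: h5 h6 yz (lr z); rewrite /f /= /g; lia.
rewrite -sum1_card (partition_big_imset f) /=.
by apply: leq_sum => p _; rewrite sum1dep_card; apply: subset_leq_card;
  apply/subsetP => x; rewrite !inE.
Qed.

End Model.

(** * Deletion sets in terms of the vertices kept *)

Definition split_set (V : finType) (G : graph V) (K : {set V}) : Prop :=
  exists C I : {set V}, [/\ C :|: I = K, [disjoint C & I],
    {in C &, forall x y, adjc G x y},
    {in I &, forall x y, x != y -> ~~ adjc G x y} &
    forall x y, x \in C -> y \in I -> adjc G x y].

Lemma complete_split_deleteE (V : finType) (G : graph V) (X : {set V}) :
  complete_split_graph (delete G X) <-> split_set G (~: X).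
Proof.
split=> [[C [I [CI dis clC inI cCI]]]|[C [I [CI dis clC inI cCI]]]].
  exists (val @: C), (val @: I); split.
  - rewrite -imsetU CI; apply/setP => x; rewrite inE; apply/imsetP/idP.
      by move=> [y _ ->]; apply: (valP y).
    by move=> xX; exists (exist _ x xX).
  - rewrite -setI_eq0 -imsetI; last by move=> x y _ _; apply: val_inj.
    by move: dis; rewrite -setI_eq0 => /eqP->; rewrite imset0.
  - move=> _ _ /imsetP[x xC ->] /imsetP[y yC ->];
      rewrite /adjc (inj_eq val_inj).
    by case: eqVneq => //= xy; apply: clC.
  - move=> _ _ /imsetP[x xI ->] /imsetP[y yI ->] xy.
    by rewrite /adjc (negPf xy) /=; apply: (inI x y).
  - move=> _ _ /imsetP[x xC ->] /imsetP[y yI ->].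
    by rewrite /adjc [adj _ _ _](cCI x y) ?orbT.
exists [set x | val x \in C], [set x | val x \in I]; split.
- apply/setP => x; rewrite !inE -in_setU CI inE; exact: (valP x).
- rewrite -setI_eq0; apply/eqP/setP => x; rewrite !inE.
  by apply/andP => -[xC xI]; move: (disjointFr dis xC); rewrite xI.
- move=> x y; rewrite !inE => xC yC xy.
  by have := clC _ _ xC yC; rewrite /adjc (inj_eq val_inj) (negPf xy).
- move=> x y; rewrite !inE => xI yI; have [->|xy] := eqVneq x y.
    by rewrite adj_irr.
  by have := inI _ _ xI yI; rewrite /adjc (inj_eq val_inj) (negPf xy) =>
    /(_ isT).
- move=> x y; rewrite !inE => xC yI; have := cCI _ _ xC yI; rewrite /adjc.
  case: (val x =P val y) => [e _|_ //].
  by move: yI; rewrite -e (disjointFr dis xC).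
Qed.

(** Transitivity of closed adjacency contracts a path edge by edge, so connected vertices are equal
    or adjacent. Conversely, [x] and [z] are connected through [y] and thus lie in one clique. *)
Lemma cluster_deleteE (V : finType) (G : graph V) (X : {set V}) :
  cluster_graph (delete G X) <->
  (forall x y z, x \notin X -> y \notin X -> z \notin X ->
     adjc G x y -> adjc G y z -> adjc G x z).
Proof.
split=> [cl x y z xX yX zX xy yz|tr x y z].
  pose x' : {v | v \notin X} := exist _ x xX.
  pose y' : {v | v \notin X} := exist _ y yX.
  pose z' : {v | v \notin X} := exist _ z zX.
  have con : forall a b : {v | v \notin X}, adjc G (val a) (val b) ->
      connect (adj (delete G X)) a b.
    move=> a b; rewrite /adjc (inj_eq val_inj) => /orP[/eqP->//|ab].
    exact: connect1.
  have := cl x' x' z'; rewrite !inE connect0 => /(_ isT).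
  have -> : connect (adj (delete G X)) x' z'.
    by apply: connect_trans (con x' y' xy) (con y' z' yz).
  move=> /(_ isT) xz; rewrite /adjc; have [//|nxz] := eqVneq x z.
  by apply: xz; apply: contraNneq nxz => /(congr1 val) /= ->.
have trv (a b c : {v | v \notin X}) : adjc G (val a) (val b) ->
    adjc G (val b) (val c) -> adjc G (val a) (val c).
  exact: tr (valP a) (valP b) (valP c).
have key (a b : {v | v \notin X}) : connect (adj (delete G X)) a b ->
    adjc G (val a) (val b).
  move=> /connectP[p]; elim: p a => [|c p IH] a /=.
    by move=> _ ->; rewrite /adjc eqxx.
  move=> /andP[ac pth] e; apply: (@trv _ c) (IH c pth e).
  by apply/orP; right.
rewrite !inE => /key xy /key xz yz.
have: adjc G (val y) (val z) by apply: (@trv _ x) xz; rewrite adjc_sym.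
by rewrite /adjc (inj_eq val_inj) (negPf yz).
Qed.

(** * Maximum weight independent sets by local ratio *)

(** The least index satisfying [phi], or [B] if there is none, written as the number of [k] such
    that no index up to [k] satisfies [phi]. In this form it can be expressed by [Sum]. *)
Definition first (B : nat) (phi : pred nat) : nat :=
  \sum_(k < B) (if [exists j : 'I_B, ~~ (k < j) && phi j] then 0 else 1).

Lemma firstP B phi :
  first B phi < B /\ phi (first B phi)
  \/ first B phi = B /\ forall j, j < B -> ~~ phi j.
Proof.
case: (boolP [exists j : 'I_B, phi j]) => [/existsP ex|/existsPn none];
  last first.
  right; split=> [|j jB]; last exact: (none (Ordinal jB)).
  rewrite /first (eq_bigr (fun=> 1)) ?sum1_card ?card_ord // => k _.
  by rewrite ifN //; apply/existsPn => j; rewrite (negPf (none j)) andbF.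
have ex' : exists j, (j < B) && phi j by case: ex => j hj; exists (val j);
  rewrite ltn_ord.
left; case: (ex_minnP ex') => m /andP[mB hm] minm.
suff -> : first B phi = m by [].
rewrite /first (eq_bigr (fun k : 'I_B => if k < m then 1 else 0)) => [|k _].
  by rewrite sum_ord_lt ?muln1 // ltnW.
case: ltnP => km.
  rewrite ifN //; apply/existsPn => j; rewrite negb_and negbK orbC -implybE.
  by apply/implyP => hj; rewrite (leq_trans km) // minm // ltn_ord.
by rewrite ifT //; apply/existsP; exists (Ordinal mB); rewrite -leqNgt km.
Qed.

Section LocalRatio.
Variables (B : nat) (h : rel nat).

Definition simplicial (r : nat -> nat) (p : nat) : bool :=
  (0 < r p) && [forall q : 'I_B, [forall q' : 'I_B,
     ~~ [&& 0 < r q, 0 < r q', h p q & h p q'] || h q q']].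

(** [p = B] stands for the absence of a pivot; then nothing is subtracted, in accordance with an
    out-of-range [Get]. *)
Definition reduce (r : nat -> nat) (p q : nat) : nat :=
  if h p q then r q - (if p < B then r p else 0) else r q.

Fixpoint residual (w : nat -> nat) (t : nat) : nat -> nat :=
  if t is t'.+1 then
    let r := residual w t' in reduce r (first B (simplicial r))
  else w.

Definition pivot (w : nat -> nat) (t : nat) : nat :=
  first B (simplicial (residual w t)).

Definition extend (I : pred nat) (p : nat) : pred nat := fun x =>
  I x || [&& x == p, p < B & ~~ [exists q : 'I_B, I q && h p q]].

(* The pivots are examined from the last one to the first one. *)
Fixpoint chosen (w : nat -> nat) (j : nat) : pred nat :=
  if j is j'.+1 then extend (chosen w j') (pivot w (B - 1 - j'))
  else xpred0.

Definition indep (J : pred nat) : Prop :=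
  forall x y, x < B -> y < B -> J x -> J y -> x != y -> ~~ h x y.

(** Positivity of the members carries the induction: a chosen neighbour of the pivot with positive
    reduced weight has lost exactly the weight of the pivot. *)
Definition max_indep (r : nat -> nat) (I : pred nat) : Prop :=
  [/\ forall x, x < B -> I x -> 0 < r x, indep I &
    forall J, indep J -> \sum_(x < B | J x) r x <= \sum_(x < B | I x) r x].

Variable w : nat -> nat.
Hypothesis h_sym : forall x y, x < B -> y < B -> 0 < w x -> 0 < w y -> h x y =
  h y x.
Hypothesis h_refl : forall x, x < B -> 0 < w x -> h x x.
Hypothesis h_simplicial : forall A : pred nat,
  (forall x, x < B -> A x -> 0 < w x) -> (exists2 x, x < B & A x) ->
  exists p, [/\ p < B, A p & forall q q', q < B -> q' < B ->
    A q -> A q' -> h p q -> h p q' -> h q q'].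

Lemma residual_le t x : residual w t x <= w x.
Proof.
elim: t => //= t IH; rewrite /reduce; case: ifP => // _.
by apply: leq_trans IH; apply: leq_subr.
Qed.

(** The local ratio step. Passing to the reduced weights costs an independent set at most [r p], and
    it costs the extended set at least [r p]; so optimality for the reduced weights carries over. *)
Lemma max_indep_extend (r : nat -> nat) (I : pred nat) :
  (forall x, r x <= w x) ->
  let p := first B (simplicial r) in
  max_indep (reduce r p) I -> max_indep r (extend I p).
Proof.
move=> rw p; rewrite {}/p; case: (firstP B (simplicial r)); last first.
  (* No pivot was found, so both [reduce] and [extend] change nothing. *)
  move=> [-> _] [I1 I2 I3].
  have rr : forall x, reduce r B x = r x.
    by move=> x; rewrite /reduce ltnn subn0 if_same.
  have eI : extend I B =1 I by move=> x; rewrite /extend ltnn andbF orbF.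
  split=> [x xB|x y xB yB|J Jin]; rewrite ?eI -?rr.
  - exact: I1.
  - exact: I2.
  - rewrite (eq_bigl _ _ (fun x : 'I_B => eI x)).
    have rS : forall K : pred nat,
        \sum_(x < B | K x) r x = \sum_(x < B | K x) reduce r B x.
      by move=> K; apply: eq_bigr => x _; rewrite rr.
    by rewrite !rS; apply: I3.
move=> [pB /andP[rp /forallP simp]]; move: (first B _) pB rp simp =>
  p pB rp simp.
have {}simp : forall q q', q < B -> q' < B -> 0 < r q -> 0 < r q' ->
    h p q -> h p q' -> h q q'.
  move=> q q' qB qB' rq rq' hq hq'.
  by have := forallP (simp (Ordinal qB)) (Ordinal qB') => /=;
    rewrite rq rq' hq hq'.
have aw : forall x, 0 < r x -> 0 < w x by move=> x; move: (rw x); lia.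
have redE : forall x, reduce r p x = if h p x then r x - r p else r x.
  by move=> x; rewrite /reduce pB.
have red_le : forall x, reduce r p x <= r x.
  by move=> x; rewrite redE; case: ifP => // _; apply: leq_subr.
move=> [I1 I2 I3].
(* The neighbours of [p] with positive weight form a clique, so an independent set has at most one
   of them to lose [r p]. *)
have upper : forall J, indep J ->
    \sum_(x < B | J x) r x <= \sum_(x < B | J x) reduce r p x + r p.
  move=> J Jin.
  apply: (@leq_trans (\sum_(x < B | J x) (reduce r p x + (if h p x && (0 < r x)
    then r p else 0)))).
    by apply: leq_sum => x _; rewrite redE; case: (h p x) => /=;
      case: (posnP (r x)); lia.
  rewrite big_split leq_add2l -big_mkcondr /= sum_nat_const.
  rewrite -[X in _ <= X]mul1n leq_mul2r; apply/orP; right.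
  apply/card_le1_eqP => x y; rewrite !unfold_in /=.
  move=> /and3P[Jx hx rx] /and3P[Jy hy ry]; apply/eqP/negPn/negP => xy.
  have := Jin y x (ltn_ord y) (ltn_ord x) Jy Jx xy.
  by rewrite (simp y x).
(* If a chosen [q] is a neighbour of [p], it accounts for the gain [r p]; if there is none, [p]
   itself is added and does. *)
case: (boolP [exists q : 'I_B, I q && h p q]) => [ex|nex].
  have eI : extend I p =1 I by move=> x; rewrite /extend ex !andbF orbF.
  split=> [x xB|x y xB yB|J Jin]; rewrite ?eI.
  - by move/(I1 x xB) => h1; apply: leq_trans (red_le x).
  - exact: I2.
  apply: leq_trans (upper J Jin) _.
  apply: (@leq_trans (\sum_(x < B | I x) reduce r p x + r p)).
    by rewrite leq_add2r I3.
  rewrite (eq_bigl _ _ (fun x : 'I_B => eI x)).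
  have [q /andP[Iq hq]] := existsP ex.
  rewrite (bigD1 q) //= [X in _ <= X](bigD1 q) //= addnAC leq_add //.
    by have := I1 q (ltn_ord q) Iq; rewrite redE hq; lia.
  by apply: leq_sum.
have Ip : I p = false.
  apply/negP => Ip; case/negP: nex; apply/existsP; exists (Ordinal pB).
  by rewrite /= Ip h_refl ?aw.
have eI : forall x, extend I p x = I x || (x == p).
  by move=> x; rewrite /extend nex pB !andbT.
split=> [x xB|x y xB yB|J Jin].
- rewrite eI => /orP[/(I1 x xB) h1|/eqP->//]; exact: leq_trans (red_le x).
- have new : forall z, z < B -> I z -> ~~ h p z.
    by move=> z zB Iz; have /existsPn/(_ (Ordinal zB)) := nex; rewrite /= Iz.
  have alive : forall z, z < B -> I z -> 0 < w z.
    by move=> z zB Iz; apply: aw; apply: leq_trans (red_le z); apply: I1.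
  rewrite !eI => /orP[Ix|/eqP->] /orP[Iy|/eqP->]; rewrite ?eqxx //.
  + exact: I2.
  + by rewrite (h_sym xB pB (alive x xB Ix) (aw p rp)) new.
  + by rewrite new.
apply: leq_trans (upper J Jin) _.
apply: (@leq_trans (\sum_(x < B | I x) reduce r p x + r p)).
  by rewrite leq_add2r I3.
rewrite [X in _ <= X](bigD1 (Ordinal pB)) /= ?eI ?eqxx ?orbT // addnC leq_add2l.
rewrite [X in _ <= X](eq_bigl (fun x : 'I_B => I x)) => [|x];
  first exact: leq_sum.
rewrite eI -val_eqE /=; case: eqP => [->|]; rewrite ?Ip ?andbT ?andbF ?orbF //.
Qed.

(** As long as some weight is positive there is a simplicial pivot, and its weight drops to 0; no
    weight ever rises. So [B] rounds exhaust all weights. *)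
Lemma residual_alive t : #|[set x : 'I_B | 0 < residual w t x]| <= B - t.
Proof.
elim: t => [|t IH]; first by rewrite subn0 (leq_trans (max_card _)) ?card_ord.
have sub : [set x : 'I_B | 0 < residual w t.+1 x] \subset
           [set x : 'I_B | 0 < residual w t x].
  apply/subsetP => x; rewrite !inE /= /reduce; case: ifP => // _.
  by move=> h1; apply: leq_trans h1 (leq_subr _ _).
have [e0|ne0] := posnP #|[set x : 'I_B | 0 < residual w t x]|.
  by apply: leq_trans (subset_leq_card sub) _; rewrite e0.
have /card_gt0P[x0] := ne0; rewrite inE => rx0.
have aw : forall x, 0 < residual w t x -> 0 < w x.
  by move=> x; move: (residual_le t x); lia.
have [||p [pB rp simp]] := h_simplicial (A := fun x => 0 < residual w t x).
- by move=> x _; apply: aw.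
- by exists (val x0); first exact: ltn_ord.
case: (firstP B (simplicial (residual w t))) =>
  [[qB /andP[rq _]]|[_ /(_ p pB)]]; last first.
  rewrite /simplicial rp /= => /negP[].
  apply/forallP => q; apply/forallP => q'; rewrite -implybE; apply/implyP.
  by move=> /and4P[rq rq' hq hq']; apply: simp.
apply: leq_trans (_ : #|[set x : 'I_B | 0 < residual w t x] :\ Ordinal qB| <=
  _).
  apply: subset_leq_card; apply/subsetP => x xin.
  rewrite in_setD1 (subsetP sub) // andbT; apply: contraTneq xin => ->.
  by rewrite inE /= /reduce h_refl ?aw // qB subnn.
by move: IH; rewrite (cardsD1 (Ordinal qB)) inE rq; lia.
Qed.

(** Induction backwards through the rounds: after all of them the weights are 0 and the empty set is
    optimal, and each [extend] undoes one reduction. *)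
Lemma chosen_max_indep : max_indep w (chosen w B).
Proof.
suff main : forall j, j <= B -> max_indep (residual w (B - j)) (chosen w j).
  by have := main B (leqnn B); rewrite subnn.
elim=> [|j IH] jB.
  split=> // J _; rewrite big1 // => x _; apply/eqP;
    rewrite -leqn0 leqNgt subn0.
  apply/negP => rx; have := residual_alive B; rewrite subnn leqNgt => /negP[].
  by apply/card_gt0P; exists x; rewrite inE.
have e : B - j = (B - 1 - j).+1 by lia.
have {}IH := IH (ltnW jB); rewrite e /= in IH.
have -> : B - j.+1 = B - 1 - j by lia.
by apply: max_indep_extend IH => x; apply: residual_le.
Qed.

End LocalRatio.

(** * The local ratio algorithm as a program *)

Lemma iteri_ind (T : Type) (P : nat -> T -> Prop) (f : nat -> T -> T) n x :
  P 0 x -> (forall k y, k < n -> P k y -> P k.+1 (f k y)) -> P n (iteri n f x).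
Proof.
move=> P0 PS; suff h : forall k, k <= n -> P k (iteri k f x) by apply: h.
elim=> //= k IH kn; apply: PS => //; apply: IH; exact: ltnW.
Qed.

(* Array 5 is the buffer of [Tab], which may thus read the array it updates.
   Arrays 6, 7, 8 hold the residual weights, the pivots and the chosen set.
   Variable 9 is never bound and holds the loop bound. *)
Definition Tab (j x : nat) (e : expr) : cmd :=
  Seq (Map 5 x e) (Map j x (Get 5 (Var x))).

Definition same_but (js : seq nat) (S S' : arrays) : Prop :=
  forall i, i \notin js -> S i = S' i.

Lemma run_Tab B j x e v S : j != 5 ->
  same_but [:: 5; j] (run B (Tab j x e) v S) S /\
  forall k, k < B -> run B (Tab j x e) v S j k = eval B S e (upd v x k).
Proof.
move=> j5; split=> [i|k kB] /=.
  by rewrite !inE negb_or => /andP[/negPf-> /negPf->].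
by rewrite eqxx upd_eq kB.
Qed.

Section Mwis.
Variable h : expr -> expr -> form.

Definition pos (j x : nat) : form := Flt (Num 0) (Get j (Var x)).

Definition pivot_expr : expr :=
  Sum 2 (Ite (Fex 3 (Fand (Fnot (Flt (Var 2) (Var 3)))
    (Fand (pos 6 3) (Fall 4 (Fall 5 (For_ (Fnot (Fand (pos 6 4)
      (Fand (pos 6 5) (Fand (h (Var 3) (Var 4)) (h (Var 3) (Var 5))))))
      (h (Var 4) (Var 5))))))))
    (Num 0) (Num 1)).

(** There is no assignment to a single entry: the pivot of round [Var 1] is recorded by rewriting
    array 7 as a whole. *)
Definition push_cmd : cmd := For 1 (Seq
  (Tab 7 6 (Ite (Feq (Var 6) (Var 1)) pivot_expr (Get 7 (Var 6))))
  (Tab 6 6 (Ite (h (Get 7 (Var 1)) (Var 6))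
                (Sub (Get 6 (Var 6)) (Get 6 (Get 7 (Var 1))))
                (Get 6 (Var 6))))).

Definition pop_cmd : cmd :=
  let p := Get 7 (Sub (Sub (Var 9) (Num 1)) (Var 1)) in
  For 1 (Tab 8 6 (Ite (For_ (pos 8 6) (Fand (Feq (Var 6) p)
      (Fand (Flt p (Var 9)) (Fnot (Fex 3 (Fand (pos 8 3) (h p (Var 3))))))))
    (Num 1) (Num 0))).

Definition mwis_cmd : cmd :=
  Seq push_cmd (Seq (Map 8 6 (Num 0)) pop_cmd).

Variables (B : nat) (hh : rel nat) (S0 : arrays).
Hypothesis hE : forall S v a b, same_but [:: 5; 6; 7; 8] S S0 ->
  holds B S (h a b) v = hh (eval B S a v) (eval B S b v).
Let w := S0 6.

(** By [hE], the relation expressed by [h] is unaffected by the working arrays 5 to 8, so it stays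
    the same through all rounds. *)
Lemma push_correct v : v 9 = B ->
  let S := run B push_cmd v S0 in
  same_but [:: 5; 6; 7; 8] S S0 /\
  forall k, k < B -> S 7 k = pivot B hh w k.
Proof.
move=> v9 S; suff [h1 h2 h3] : [/\ same_but [:: 5; 6; 7; 8] S S0,
   forall x, x < B -> S 6 x = residual B hh w B x &
   forall k, k < B -> S 7 k = pivot B hh w k] by [].
pose P t S := [/\ same_but [:: 5; 6; 7; 8] S S0,
   forall x, x < B -> S 6 x = residual B hh w t x &
   forall k, k < t -> S 7 k = pivot B hh w k].
rewrite {}/S; apply: (iteri_ind (P := P)) => // t S tB [h1 h2 h3].
set u := upd v 1 t.
have ep : forall k, eval B S pivot_expr (upd u 6 k) = pivot B hh w t.
  move=> k; rewrite /pivot_expr /=; apply: eq_bigr => i _.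
  congr (if _ then _ else _); apply: eq_existsb => j.
  rewrite /upd /= !ltn_ord h2 // /simplicial; congr (_ && (_ && _)).
  apply: eq_forallb => q; apply: eq_forallb => q'.
  by rewrite !hE // /upd /= !ltn_ord !h2.
have [s1 e1] := run_Tab B 6
  (Ite (Feq (Var 6) (Var 1)) pivot_expr (Get 7 (Var 6))) u S (isT : 7 != 5).
set S1 := run B (Tab 7 6 _) u S in s1 e1.
have [s2 e2] := run_Tab B 6 (Ite (h (Get 7 (Var 1)) (Var 6))
                (Sub (Get 6 (Var 6)) (Get 6 (Get 7 (Var 1))))
                (Get 6 (Var 6))) u S1 (isT : 6 != 5).
set S2 := run B (Tab 6 6 _) u S1 in s2 e2.
suff : P t.+1 S2 by [].
have h1' : same_but [:: 5; 6; 7; 8] S1 S0.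
  move=> i; rewrite !inE !negb_or => /and4P[i5 i6 i7 i8].
  by rewrite s1 ?h1 // !inE !negb_or ?i5 ?i6 ?i7.
have S17 : forall k, k < t.+1 -> S1 7 k = pivot B hh w k.
  move=> k; rewrite ltnS => kt; have kB := leq_ltn_trans kt tB.
  rewrite e1 //= {1 2}/upd /=.
  case: eqP => [->|/eqP nkt]; first by rewrite -(ep t).
  by rewrite /upd /= kB h3 // ltn_neqAle nkt.
have S16 : forall x, x < B -> S1 6 x = residual B hh w t x.
  by move=> x xB; rewrite s1 ?h2.
split.
- move=> i; rewrite !inE !negb_or => /and4P[i5 i6 i7 i8].
  by rewrite s2 ?h1' // !inE !negb_or ?i5 ?i6 ?i7.
- move=> x xB; rewrite e2 //= hE //= /upd /= tB xB S17 //.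
  by rewrite S16 // /reduce -/(pivot B hh w t); case: ifP => // _;
    case: ifP => // pB; rewrite S16.
- by move=> k kt; rewrite s2 // S17.
Qed.

Lemma mwis_correct v : v 9 = B ->
  let S := run B mwis_cmd v S0 in
  same_but [:: 5; 6; 7; 8] S S0 /\
  forall k, k < B -> S 8 k = chosen B hh w B k.
Proof.
move=> v9 S; have [s1 e1] := push_correct v9.
set S1 := run B push_cmd v S0 in s1 e1.
pose P j S := [/\ same_but [:: 5; 6; 7; 8] S S0,
   forall k, k < B -> S 7 k = pivot B hh w k &
   forall x, x < B -> S 8 x = chosen B hh w j x].
suff [] : P B S by [].
rewrite {}/S; apply: (iteri_ind (P := P)).
  suff : P 0 (run B (Map 8 6 (Num 0)) v S1) by [].
  split=> //= i; rewrite !inE !negb_or => /and4P[i5 i6 i7 i8].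
  by rewrite (negPf i8) s1 // !inE !negb_or i5 i6 i7.
move=> j S jB [h1 h2 h3].
set p := Get 7 (Sub (Sub (Var 9) (Num 1)) (Var 1)).
set u := upd v 1 j.
set e := Ite _ _ _.
have [s2 e2] := run_Tab B 6 e u S (isT : 8 != 5).
set S2 := run B (Tab 8 6 _) u S in s2 e2.
suff : P j.+1 S2 by [].
split.
- move=> i; rewrite !inE !negb_or => /and4P[i5 i6 i7 i8].
  by rewrite s2 ?h1 // !inE !negb_or ?i5 ?i6 ?i7.
- by move=> k kB; rewrite s2 // h2.
have pB : B - 1 - j < B by lia.
move=> x xB; rewrite e2 // /e /p [eval _ _ _ _]/= {e2}.
rewrite (eq_existsb (P2 := fun k : 'I_B =>
  chosen B hh w j k && hh (pivot B hh w (B - 1 - j)) k)) => [|k].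
  rewrite /u /upd /= v9 pB xB h2 // h3 // /extend.
  by case: (chosen B hh w j x) => //=; case: ifP.
by rewrite hE //= /u /upd /= v9 pB ltn_ord h2 // h3 //; case: chosen.
Qed.
End Mwis.

(** * Access to the input graph *)

(* Array 1 holds the number [n] of vertices, array 2 the row offsets [i * n]
   of the adjacency matrix; arrays 3 and 4 decode [p] as the pair of vertices
   [(p %/ n, p %% n)]. *)
Definition order_expr : expr := Get 1 (Num 0).

Definition decode_cmd : cmd :=
  Seq (Map 1 6 side_expr)
 (Seq (Map 2 6 (Sum 3 (Ite (Flt (Var 3) (Var 6)) order_expr (Num 0))))
 (Seq (Map 3 6 (Sum 3 (Ite (Flt (Var 6) (Add (Get 2 (Var 3)) order_expr))
                           (Num 0) (Num 1))))
      (Map 4 6 (Sub (Var 6) (Get 2 (Get 3 (Var 6))))))).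

(** The range tests make the formula false on numbers that are not vertices, whose matrix index
    might fall into another row. The equality makes neighbourhoods closed. *)
Definition adj_form (a b : expr) : form :=
  Fand (Flt a order_expr) (Fand (Flt b order_expr)
    (For_ (Feq a b) (Flt (Num 0) (Get 0 (Add (Get 2 a) b))))).


Lemma nth_allpairs (S T R : Type) (f : S -> T -> R) s t x0 y0 z0 i j :
  i < size s -> j < size t ->
  nth z0 [seq f x y | x <- s, y <- t] (i * size t + j) = f (nth x0 s i)
    (nth y0 t j).
Proof.
elim: s i => // x s IH [|i] /= ile jt.
  by rewrite nth_cat size_map jt (nth_map y0).
by rewrite nth_cat size_map mulSn -addnA ltnNge leq_addr /= addKn IH.
Qed.

Section Static.
Variables (n : nat) (G : graph 'I_n).
Let B := n * n.

Definition adjn (a b : nat) : bool :=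
  if insub a is Some x then
    if insub b is Some y then adjc G x y else false
  else false.

Lemma adjnE (x y : 'I_n) : adjn x y = adjc G x y.
Proof. by rewrite /adjn !valK. Qed.

Lemma adjn_lt a b : adjn a b -> a < n /\ b < n.
Proof. by rewrite /adjn; case: insubP => // x ? _; case: insubP. Qed.

Lemma adjn_sym a b : adjn a b = adjn b a.
Proof.
rewrite /adjn; case: insubP => [x _ _|_]; case: insubP => // y _ _.
exact: adjc_sym.
Qed.

Lemma adjn_refl a : a < n -> adjn a a.
Proof. by move=> an; rewrite -[a]/(val (Ordinal an)) adjnE /adjc eqxx. Qed.

Lemma nth_encode_graph (x y : 'I_n) :
  nth false (encode_graph G) (x * n + y) = adj G x y.
Proof.
have := @nth_allpairs _ _ _ (fun x y => adj G x y) (enum 'I_n) (enum 'I_n)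
  x y false x y.
by rewrite size_enum_ord !nth_ord_enum; apply.
Qed.

Lemma leq_sqr : n <= B. Proof. by rewrite /B; nia. Qed.

Lemma divn_lt_sqr p : p < B -> p %/ n < n.
Proof. by move=> pB; rewrite ltn_divLR //; move: pB; rewrite /B; case: (n). Qed.

Definition decoded : arrays :=
  run B decode_cmd (fun=> B) (initial (encode_graph G)).

Lemma decoded1 i : decoded 1 i = n.
Proof. exact: side_exprP. Qed.

Lemma decoded2 i : i < B -> decoded 2 i = i * n.
Proof.
move=> iB; rewrite -(@sum_ord_lt B) ?(ltnW iB) //.
have B0 : 0 < B by apply: leq_ltn_trans iB.
rewrite -[decoded 2 i]/(\sum_(k < B) if k < i then (if 0 < B then decoded 1 0
  else 0) else 0).
by rewrite B0 decoded1.
Qed.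

Lemma decoded3 i : i < B -> decoded 3 i = i %/ n.
Proof.
move=> iB; have B0 : 0 < B by apply: leq_ltn_trans iB.
have n0 : 0 < n by move: B0; rewrite muln_gt0; case/andP.
rewrite -[decoded 3 i]/(\sum_(k < B) if i < (if k < B then decoded 2 k else 0)
  + (if 0 < B then decoded 1 0 else 0) then 0 else 1).
(* The quotient counts the rows that end at or before position [i]. *)
rewrite (eq_bigr (fun k : 'I_B => if k < i %/ n then 1 else 0)) => [|k _].
  by rewrite sum_ord_lt ?muln1 // (leq_trans (ltnW (divn_lt_sqr iB)))
    // leq_sqr.
rewrite ltn_ord B0 decoded1 decoded2 // -mulSnr leq_divRL // ltnNge.
by case: (_ <= _).
Qed.

Lemma decoded4 i : i < B -> decoded 4 i = i %% n.
Proof.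
move=> iB; rewrite -[decoded 4 i]/(i - (if (if i < B then decoded 3 i else 0)
  < B
  then decoded 2 (if i < B then decoded 3 i else 0) else 0)).
have dB : i %/ n < B by apply: leq_trans (divn_lt_sqr iB) leq_sqr.
by rewrite iB decoded3 // dB decoded2 // {1}(divn_eq i n) addKn.
Qed.

(** The input and its decoding; they stay intact until the last command writes the answer to array
    0. *)
Definition static (S : arrays) : Prop := forall j, j < 5 -> S j = decoded j.

Lemma order_exprE S v : static S -> eval B S order_expr v = n.
Proof.
(* For [n = 0] the arrays are empty and the read yields 0, which is still the order. *)
move=> st; rewrite /order_expr /= st // decoded1; case: posnP => // /eqP.
by rewrite /B muln_eq0 orbb => /eqP->.
Qed.

Lemma adj_formE S v a b : static S ->
  holds B S (adj_form a b) v = adjn (eval B S a v) (eval B S b v).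
Proof.
move=> st; rewrite /adj_form.
rewrite -[holds _ _ _ _]/[&& eval B S a v < eval B S order_expr v,
  eval B S b v < eval B S order_expr v & (eval B S a v == eval B S b v) ||
  (0 < eval B S (Get 0 (Add (Get 2 a) b)) v)].
rewrite !order_exprE // /=; move: (eval B S a v) (eval B S b v) => i j.
rewrite /adjn; case: insubP => [x xn ex|/negPf->//]; rewrite -ex {i xn ex}.
case: insubP => [y yn ey|/negPf->]; last by rewrite andbF.
rewrite -ey {j yn ey} !ltn_ord /adjc /= val_eqE; congr (_ || _).
have xB : x < B by apply: leq_trans (ltn_ord x) leq_sqr.
rewrite xB !st // decoded2 //.
have -> : x * n + y < B by move: (ltn_ord x) (ltn_ord y); rewrite /B; nia.
rewrite -[decoded 0 _]/(nat_of_bool (nth false (encode_graph G) (x * n + y))).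
by rewrite nth_encode_graph; case: (adj G x y).
Qed.

Lemma sum_ord_sqr (phi : pred nat) : (forall x, phi x -> x < n) ->
  \sum_(x < B) phi x = #|[set x : 'I_n | phi x]|.
Proof.
move=> hphi; rewrite cardsE -sum1_card [RHS]big_mkcond /=.
rewrite (eq_bigr (fun x : 'I_n => nat_of_bool (phi x))) => [|x _]; last first.
  by rewrite unfold_in; case: (phi x).
rewrite (big_ord_widen _ (fun x => nat_of_bool (phi x)) leq_sqr)
  [RHS]big_mkcond /=.
apply: eq_bigr => x _; case: ltnP => // nx.
by case hx: (phi x) => //; move: (hphi _ hx); rewrite ltnNge nx.
Qed.

End Static.

(** * Complete split graphs *)

(* Array 9 is [C], array 11 the candidate [C :|: I] of the current pair (held
   by variable 0), array 10 the best candidate so far. *)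
Definition split_body : cmd :=
  Seq (Map 9 6 (Ite (Fand (adj_form (Var 6) (Get 3 (Var 0)))
                          (adj_form (Var 6) (Get 4 (Var 0)))) (Num 1) (Num 0)))
 (Seq (Map 6 6 (Ite (Fand (Flt (Var 6) order_expr) (Fand (Fnot (pos 9 6))
          (Fall 3 (For_ (Fnot (pos 9 3)) (adj_form (Var 6) (Var 3))))))
        (Num 1) (Num 0)))
 (Seq (mwis_cmd adj_form)
 (Seq (Map 11 6 (Ite (Fand
          (Fall 3 (Fall 4 (For_ (Fnot (Fand (pos 9 3) (pos 9 4)))
                                (adj_form (Var 3) (Var 4)))))
          (For_ (pos 9 6) (pos 8 6))) (Num 1) (Num 0)))
      (Tab 10 6 (Ite (Flt (Sum 3 (Get 10 (Var 3))) (Sum 3 (Get 11 (Var 3))))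
                     (Get 11 (Var 6)) (Get 10 (Var 6))))))).

Definition split_cmd : cmd :=
  Seq decode_cmd (Seq (Map 10 6 (Num 0)) (Seq (For 0 split_body)
    (Map 0 6 (Ite (pos 10 6) (Num 0) (Num 1))))).

Local Opaque adj_form order_expr.

Section Members.
Variable n : nat.
Implicit Type K : {set 'I_n}.

Definition members K (x : nat) : bool :=
  if insub x is Some y then y \in K else false.

Lemma membersE K (x : 'I_n) : members K x = (x \in K).
Proof. by rewrite /members valK. Qed.

Lemma members_lt K x : members K x -> x < n.
Proof. by rewrite /members; case: insubP. Qed.

Lemma sum_members K : \sum_(x < n * n) members K x = #|K|.
Proof.
rewrite sum_ord_sqr; last exact: members_lt.
by congr #|pred_of_set _|; apply/setP => x; rewrite inE membersE.
Qed.

Lemma members_set (phi : pred nat) : (forall x, phi x -> x < n) ->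
  members [set x : 'I_n | phi x] =1 phi.
Proof.
move=> hphi x; rewrite /members; case: insubP => [y _ <-|];
  first by rewrite inE.
by move=> nx; apply/esym/negbTE; apply: contra nx => /hphi.
Qed.

End Members.

(** * Correctness of the complete split program *)

Section SplitCorrect.
Variables (n : nat) (G : graph 'I_n) (l r : 'I_n -> nat).
Hypothesis lr : forall x, l x < r x.
Hypothesis model : forall x y, adjc G x y = (l x < r y) && (l y < r x).
Let B := n * n.

(** The vertex whose interval ends first is simplicial: all its neighbours contain the last point of
    its interval. *)
Lemma adjn_simplicial (w : nat -> nat) (A : pred nat) :
  (forall x, x < B -> 0 < w x -> x < n) ->
  (forall x, x < B -> A x -> 0 < w x) -> (exists2 x, x < B & A x) ->
  exists p, [/\ p < B, A p & forall q q', q < B -> q' < B ->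
    A q -> A q' -> adjn G p q -> adjn G p q' -> adjn G q q'].
Proof.
move=> wn Aw [x0 x0B Ax0].
have An : forall x, x < B -> A x -> x < n by move=> x xB /Aw xw;
  apply: wn (xw _).
case: (@arg_minnP _ (Ordinal (An x0 x0B Ax0)) (fun y => A (val y)) r Ax0) =>
  p Ap minp; exists p; split=> //.
  by apply: leq_trans (ltn_ord p) (leq_sqr n).
move=> q q' qB qB' Aq Aq'.
have [y ey] : exists y : 'I_n, val y = q by exists (Ordinal (An q qB Aq)).
have [y' ey'] : exists y : 'I_n, val y = q' by exists (Ordinal (An q' qB' Aq')).
subst q q'; have /= := minp y Aq; have /= := minp y' Aq'.
by rewrite !adjnE !model; lia.
Qed.

Definition common (k : nat) : {set 'I_n} :=
  [set x : 'I_n | adjn G x (k %/ n) && adjn G x (k %% n)].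

(** No candidate built on the pair coded by [k] has more than [m] vertices; this is vacuous if the
    common neighbourhood is not a clique. *)
Definition pair_bound (k m : nat) : Prop :=
  {in common k &, forall x y, adjc G x y} ->
  forall I0 : {set 'I_n}, {in I0 &, forall x y, x != y -> ~~ adjc G x y} ->
  (forall x, x \in I0 -> x \notin common k /\
     forall y, y \in common k -> adjc G x y) ->
  #|common k| + #|I0| <= m.

Definition joined (k x : nat) : bool := [&& x < n, ~~ members (common k) x &
  [forall y : 'I_B, ~~ members (common k) y || adjn G x y]].

Lemma joinedP k (x : 'I_n) : reflect
  (x \notin common k /\ forall y, y \in common k -> adjc G x y) (joined k x).
Proof.
rewrite /joined ltn_ord membersE /=; apply: (iffP andP) => -[h1 h2]; split=> //.
  move=> y yC; have yB : y < B by apply: leq_trans (ltn_ord y) (leq_sqr n).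
  by have := forallP h2 (Ordinal yB); rewrite membersE yC adjnE.
apply/forallP => y; case my : (members _ y) => //=.
have yn := members_lt my; have ey : val y = val (Ordinal yn) by [].
by move: my; rewrite ey membersE adjnE; apply: h2.
Qed.

(** The weights are 0 or 1, so maximum weight means maximum cardinality among the vertices joined to
    the clique. If the common neighbourhood is not a clique, the candidate is empty. *)
Lemma candidate_correct (k : nat) (w : nat -> nat) (I : pred nat) :
  (forall x, x < B -> w x = joined k x) ->
  max_indep B (adjn G) w I ->
  let cl := [forall x : 'I_B, [forall y : 'I_B,
     ~~ (members (common k) x && members (common k) y) || adjn G x y]] in
  let K := [set x : 'I_n | cl && (members (common k) x || I x)] in
  split_set G K /\ pair_bound k #|K|.
Proof.
move=> wE [I1 I2 I3] cl K.
have oB (x : 'I_n) : x < B by apply: leq_trans (ltn_ord x) (leq_sqr n).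
have Ij (x : 'I_n) : I x -> joined k x.
  by move=> /(I1 x (oB x)); rewrite wE //; case: joined.
have clP : reflect {in common k &, forall x y, adjc G x y} cl.
  apply: (iffP forallP) => [h x y xC yC|h x].
    have := forallP (h (Ordinal (oB x))) (Ordinal (oB y)).
    by rewrite !membersE xC yC adjnE.
  apply/forallP => y; rewrite -implybE; apply/implyP => /andP[mx my].
  move: mx my (members_lt mx) (members_lt my) => mx my xn yn; move: mx my.
  rewrite -[val x]/(val (Ordinal xn)) -[val y]/(val (Ordinal yn)).
  by rewrite !membersE adjnE; apply: h.
have dis : [disjoint common k & [set x : 'I_n | I x]].
  rewrite -setI_eq0; apply/eqP/setP => x; rewrite !inE; apply/negP => /andP[xC].
  by move=> /Ij/joinedP[]; rewrite inE xC.
case: (boolP cl) => hcl; last first.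
  have -> : K = set0 by apply/setP => x; rewrite !inE (negPf hcl).
  split; last by move=> /clP; rewrite (negPf hcl).
  exists set0, set0; split; rewrite ?setU0 // ?disjoints_subset ?sub0set //.
  - by move=> x y; rewrite inE.
  - by move=> x y; rewrite inE.
  - by move=> x y; rewrite inE.
have KE : K = common k :|: [set x : 'I_n | I x].
  by apply/setP => x; rewrite !inE hcl membersE inE.
have cK : #|K| = #|common k| + #|[set x : 'I_n | I x]|.
  by rewrite KE cardsU (disjoint_setI0 dis) cards0 subn0.
split.
  exists (common k), [set x : 'I_n | I x]; split=> //.
  - exact/clP.
  - move=> x y; rewrite !inE -adjnE => Ix Iy xy.
    exact: (I2 x y (oB x) (oB y) Ix Iy xy).
  - move=> x y xC; rewrite inE adjc_sym => /Ij/joinedP[_]; exact.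
move=> _ I0 inI0 I0W; rewrite cK leq_add2l.
have I0j (x : 'I_n) : x \in I0 -> joined k x by move=> /I0W/joinedP.
have J0 : indep B (adjn G) (members I0).
  move=> x y _ _ mx my; move: mx my (members_lt mx) (members_lt my) =>
    mx my xn yn.
  move: mx my; rewrite -[x]/(val (Ordinal xn)) -[y]/(val (Ordinal yn)).
  by rewrite !membersE adjnE; apply: inI0.
have sI : \sum_(x < B | I x) w x = #|[set x : 'I_n | I x]|.
  have -> : [set x : 'I_n | I x] = [set x : 'I_n | I x && (x < n)].
    by apply/setP => x; rewrite !inE ltn_ord andbT.
  rewrite -(@sum_ord_sqr n (fun x => I x && (x < n))); last by move=> x /andP[].
  rewrite big_mkcond; apply: eq_bigr => x _ /=; case: ifP => // Ix.
  have := I1 x (ltn_ord x) Ix; rewrite wE ?ltn_ord //.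
  by case jx: joined => // _; case/and3P: jx => ->.
rewrite -sI -(sum_members I0); apply: leq_trans (I3 _ J0).
rewrite [X in _ <= X]big_mkcond leq_sum // => x _;
  case mx: (members I0 x) => //.
rewrite wE ?ltn_ord //; have xn := members_lt mx.
by move: mx; rewrite -[val x]/(val (Ordinal xn)) membersE => /I0j->.
Qed.

Lemma static_Map j x e v S : 4 < j -> static G S -> static G (run B (Map j x e)
  v S).
Proof. by move=> j5 st i i5; rewrite /= ifN ?st // neq_ltn (leq_trans i5). Qed.

Lemma static_same_but js S S' : all (leq 5) js -> same_but js S' S ->
  static G S -> static G S'.
Proof.
move=> /allP js5 sb st i i5; rewrite sb ?st //.
by apply: contraL i5 => /js5; rewrite -leqNgt.
Qed.

Definition split_inv (t : nat) (S : arrays) : Prop :=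
  static G S /\ exists K, [/\ split_set G K,
    forall x, x < B -> S 10 x = members K x &
    forall k, k < t -> pair_bound k #|K|].

Lemma split_body_correct t S : t < B -> split_inv t S ->
  split_inv t.+1 (run B split_body (upd (fun=> B) 0 t) S).
Proof.
move=> tB [st [K [sK S10 bK]]].
rewrite /split_body; set c1 := Map 9 _ _; set c2 := Map 6 _ _.
set c4 := Map 11 _ _; set c5 := Tab 10 _ _; set u := upd _ 0 t.
pose S1 := run B c1 u S; pose S2 := run B c2 u S1.
pose S3 := run B (mwis_cmd adj_form) u S2; pose S4 := run B c4 u S3.
suff : split_inv t.+1 (run B c5 u S4) by [].
have st1 : static G S1 by apply: static_Map.
have st2 : static G S2 by apply: static_Map.
have commonE : members (common t) =1
    (fun x => adjn G x (t %/ n) && adjn G x (t %% n)).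
  by apply: members_set => x /andP[/adjn_lt[]].
have S19 x : S1 9 x = members (common t) x.
  by rewrite commonE /S1 /c1 /= !(@adj_formE n G)
    //= /u /upd /= tB !st // decoded3 // decoded4.
have S26 x : x < B -> S2 6 x = joined t x.
  move=> xB; rewrite /S2 /c2 /= (@order_exprE n G) // /u /upd /= xB S19.
  rewrite (eq_forallb (P2 := fun y : 'I_B =>
    ~~ members (common t) y || adjn G x y)) => [|y].
    by rewrite /joined lt0b; case: [&& _, _ & _].
  by rewrite ltn_ord S19 lt0b (@adj_formE n G).
have [] := @mwis_correct adj_form B (adjn G) S2 _ u erefl.
  move=> S' v a b sb; apply: (@adj_formE n G); exact: static_same_but sb st2.
rewrite -/S3; set I := chosen _ _ _ _ => sb3 S38.
have st3 : static G S3 by apply: static_same_but sb3 st2.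
have mxI : max_indep B (adjn G) (S2 6) I.
  apply: chosen_max_indep.
  - by move=> x y _ _ _ _; apply: adjn_sym.
  - move=> x xB; rewrite S26 // lt0b => /and3P[xn _ _]; exact: adjn_refl.
  - move=> A; apply: adjn_simplicial => x xB.
    by rewrite S26 // lt0b => /and3P[].
have [] := candidate_correct S26 mxI.
set cl := [forall x, _]; set Kc := [set x | _] => sKc bKc.
have S39 x : S3 9 x = members (common t) x by rewrite sb3 // -S19.
have KcE x : x < B -> members Kc x = cl && (members (common t) x || I x).
  move=> xB; rewrite {1}/members; case: insubP => [y _ <-|nx].
    by rewrite inE.
  apply/esym/negbTE; apply: contra nx => /andP[_ /orP[/members_lt//|Ix]].
  by have [/(_ x xB Ix)] := mxI; rewrite S26 // lt0b => /and3P[].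
have S411 x : x < B -> S4 11 x = members Kc x.
  move=> xB; rewrite KcE // /S4 /c4 /= /u /upd /= xB S39 S38 // !lt0b.
  rewrite (eq_forallb (P2 := fun x : 'I_B => [forall y : 'I_B,
     ~~ (members (common t) x && members (common t) y) || adjn G x y])) => [|z].
    by rewrite -/cl; case: (_ && _).
  apply: eq_forallb => y.
  by rewrite !ltn_ord !S39 !lt0b (@adj_formE n G).
have S410 x : x < B -> S4 10 x = members K x.
  by move=> xB; rewrite -S10 // /S4 /c4 /= sb3.
have [sb5 S5] := run_Tab B 6 (Ite (Flt (Sum 3 (Get 10 (Var 3)))
  (Sum 3 (Get 11 (Var 3))))
                     (Get 11 (Var 6)) (Get 10 (Var 6))) u S4 (isT : 10 != 5).
rewrite -/c5 in sb5 S5.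
split; first by apply: static_same_but sb5 (static_Map _ _ _ _ st3).
have cardE (K' : {set 'I_n}) j : (forall x, x < B -> S4 j x = members K' x) ->
    forall v, \sum_(k < B) eval B S4 (Get j (Var 3)) (upd v 3 k) = #|K'|.
  move=> e v; rewrite -(sum_members K') -/B; apply: eq_bigr => x _.
  by rewrite /= /upd /= ltn_ord e.
have S5E x : x < B -> run B c5 u S4 10 x = if #|K| < #|Kc| then members Kc x
  else members K x.
  move=> xB; rewrite S5 //.
  rewrite -[LHS]/(if \sum_(k < B) eval B S4 (Get 10 (Var 3)) (upd (upd u 6 x)
    3 k) <
    \sum_(k < B) eval B S4 (Get 11 (Var 3)) (upd (upd u 6 x) 3 k) then
    eval B S4 (Get 11 (Var 6)) (upd u 6 x) else eval B S4 (Get 10 (Var 6))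
      (upd u 6 x)).
  by rewrite (cardE _ _ S410) (cardE _ _ S411) /= /upd /= xB S410 // S411 //;
    case: ifP.
have mono k m m' : m <= m' -> pair_bound k m -> pair_bound k m'.
  by move=> le b h1 I0 h2 h3; apply: leq_trans le; apply: b.
exists (if #|K| < #|Kc| then Kc else K); split.
- by case: ifP.
- by move=> x xB; rewrite S5E //; case: ifP.
move=> k; rewrite ltnS leq_eqVlt => /orP[/eqP->|kt].
  by case: ltnP => h; first exact: bKc; apply: mono bKc.
by case: ltnP => h; [apply: mono (ltnW h) (bK k kt)|apply: bK].
Qed.

Lemma pair_index (u v : 'I_n) :
  [/\ u * n + v < B, (u * n + v) %/ n = u & (u * n + v) %% n = v].
Proof.
have n0 : 0 < n by apply: leq_ltn_trans (ltn_ord u).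
split; first by move: (ltn_ord u) (ltn_ord v); rewrite /B; nia.
  by rewrite divnMDl // divn_small ?addn0.
by rewrite modnMDl modn_small.
Qed.

Lemma card_setC_le (X Y : {set 'I_n}) : #|~: Y| <= #|~: X| -> #|X| <= #|Y|.
Proof. by rewrite -(leq_add2l #|X|) cardsC -(cardsC Y) leq_add2r. Qed.

Lemma split_cmd_correct :
  exists2 X, min_deletion_set complete_split_graph G X &
    forall x : 'I_n,
      (run B split_cmd (fun=> B) (initial (encode_graph G)) 0 x != 0)
        = (x \in X).
Proof.
pose S1 := run B (Map 10 6 (Num 0)) (fun=> B) (decoded G).
pose S2 := run B (For 0 split_body) (fun=> B) S1.
have [st [K [sK S10 bK]]] : split_inv B S2.
  apply: (iteri_ind (P := split_inv)) => [|t S tB];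
    last exact: split_body_correct.
  split; first exact: static_Map.
  exists set0; split=> // [|x xB].
    by exists set0, set0; split; rewrite ?setU0 ?disjoints_subset ?sub0set //;
      move=> x y; rewrite inE.
  by rewrite /members; case: insubP => // y _ _; rewrite inE.
exists (~: K).
  split; first by apply/complete_split_deleteE; rewrite setCK.
  move=> Y /complete_split_deleteE[C [I [CI dis clC inI cCI]]].
  apply: card_setC_le; rewrite setCK -CI.
  (* [split_optimal] has to pick vertices [u] and [v], so an empty remainder is treated apart. *)
  have [->|ne0] := eqVneq (C :|: I) set0; first by rewrite cards0.
  have [||| |u [v [clD [I0 inI0 [I0W le]]]]] := @split_optimal _ l r lr C I.
  - by move=> x y xC yC; rewrite -model clC.
  - by move=> x y xI yI; rewrite -model; apply: inI.
  - by move=> x y xC yI; rewrite -model cCI.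
  - by [].
  have [kB ku kv] := pair_index u v.
  have eC : [set x | (l x < r u) && (l u < r x) && ((l x < r v) && (l v < r x))]
            = common (u * n + v).
    by apply/setP => x; rewrite !inE ku kv !adjnE !model.
  apply: leq_trans le _; rewrite eC; apply: bK => //.
  - by move=> x y xC yC; rewrite model; apply: clD; rewrite eC.
  - by move=> x y xI yI xy; rewrite model; apply: inI0.
  move=> x /I0W[]; rewrite eC => h1 h2; split=> // y yC.
  by rewrite model; apply: h2.
(* Array 10 holds the vertices kept; the output is the complement. *)
move=> x; rewrite -[run _ _ _ _ 0 x]/(if 0 < (if x < B then S2 10 x else 0)
  then 0 else 1).
have xB : x < B by apply: leq_trans (ltn_ord x) (leq_sqr n).
by rewrite xB S10 // membersE inE lt0b; case: (x \in K).
Qed.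

End SplitCorrect.

Lemma split_cmd_wf : wf split_cmd.
Proof. by vm_compute. Qed.

(** * Cluster graphs *)

(* [p] and [q] stand for pairs of vertices: the set [N[q.1] :&: N[q.2]] within
   the vertices whose neighbourhood is covered by that of the pair [p]. *)
Definition block_form (p q : expr) (x : nat) : form :=
  Fand (adj_form (Var x) (Get 3 q)) (Fand (adj_form (Var x) (Get 4 q))
    (Fall 7 (For_ (Fnot (adj_form (Var x) (Var 7)))
      (For_ (adj_form (Var 7) (Get 3 p)) (adj_form (Var 7) (Get 4 p)))))).

(** By [maximal_clique_pair], every nonempty clique of covered vertices lies in a block that is a
    clique. So the largest value over all [q] is the maximum clique size, with the other blocks
    counted as 0. *)
Definition block_size_expr (p q : expr) : expr :=
  Ite (Fall 4 (Fall 5 (For_ (Fnot (Fand (block_form p q 4) (block_form p q 5)))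
                            (adj_form (Var 4) (Var 5)))))
      (Sum 4 (Ite (block_form p q 4) (Num 1) (Num 0))) (Num 0).

Definition best_block_expr : expr :=
  Sum 2 (Ite (Fex 3 (Fand (Fnot (Flt (Var 2) (Var 3)))
     (Fall 8 (Fnot (Flt (block_size_expr (Var 6) (Var 3))
                        (block_size_expr (Var 6) (Var 8)))))))
   (Num 0) (Num 1)).

Definition touch_form (a b : expr) : form :=
  For_ (adj_form (Get 3 a) (Get 3 b)) (For_ (adj_form (Get 3 a) (Get 4 b))
    (For_ (adj_form (Get 4 a) (Get 3 b)) (adj_form (Get 4 a) (Get 4 b)))).

Definition cluster_cmd : cmd :=
  Seq decode_cmd
 (Seq (Map 9 6 best_block_expr)
 (Seq (Map 6 6 (Ite (adj_form (Get 3 (Var 6)) (Get 4 (Var 6)))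
                    (block_size_expr (Var 6) (Get 9 (Var 6))) (Num 0)))
 (Seq (mwis_cmd touch_form)
      (Tab 0 6 (Ite (Fex 3 (Fand (pos 8 3)
                       (block_form (Var 3) (Get 9 (Var 3)) 6)))
                    (Num 0) (Num 1)))))).

Lemma cluster_cmd_wf : wf cluster_cmd.
Proof. by vm_compute. Qed.

(** * Correctness of the cluster program *)

Section ClusterCorrect.
Variables (n : nat) (G : graph 'I_n) (l r : 'I_n -> nat).
Hypothesis lr : forall x, l x < r x.
Hypothesis model : forall x y, adjc G x y = (l x < r y) && (l y < r x).
Let B := n * n.

(** The value 0 out of range copies [Get], so that [block] and [touch] agree with their formulas on
    all numbers. *)
Definition fst_vertex (p : nat) : nat := if p < B then p %/ n else 0.
Definition snd_vertex (p : nat) : nat := if p < B then p %% n else 0.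

Definition block (p q x : nat) : bool :=
  [&& adjn G x (fst_vertex q), adjn G x (snd_vertex q) &
    [forall y : 'I_B, ~~ adjn G x y ||
      (adjn G y (fst_vertex p) || adjn G y (snd_vertex p))]].

Definition block_clique (p q : nat) : bool :=
  [forall x : 'I_B, [forall y : 'I_B,
    ~~ (block p q x && block p q y) || adjn G x y]].

Definition block_size (p q : nat) : nat :=
  if block_clique p q then \sum_(x < B) block p q x else 0.

Definition touch (p q : nat) : bool :=
  [|| adjn G (fst_vertex p) (fst_vertex q), adjn G (fst_vertex p)
    (snd_vertex q),
      adjn G (snd_vertex p) (fst_vertex q) | adjn G (snd_vertex p)
        (snd_vertex q)].

(** Excludes variable capture: the block formulas and sizes bind 4, 5 and 7 around their
    arguments. *)
Definition stable S (v : nat -> nat) (p : expr) (P : nat) : Prop :=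
  forall v', (forall y, y \notin [:: 4; 5;
    7] -> v' y = v y) -> eval B S p v' = P.

Lemma eval_fst S v p : static G S ->
  eval B S (Get 3 p) v = fst_vertex (eval B S p v).
Proof.
move=> st; rewrite /= /fst_vertex st //.
by case: ifP => // pB; rewrite decoded3.
Qed.

Lemma eval_snd S v p : static G S ->
  eval B S (Get 4 p) v = snd_vertex (eval B S p v).
Proof.
move=> st; rewrite /= /snd_vertex st //.
by case: ifP => // pB; rewrite decoded4.
Qed.

Lemma block_formE S v p q x P Q : static G S -> x != 7 ->
  stable S v p P -> stable S v q Q ->
  holds B S (block_form p q x) v = block P Q (v x).
Proof.
move=> st x7 sp sq; rewrite /block_form /block.
rewrite [LHS]/= !(@adj_formE n G) // eval_fst // eval_snd //.
rewrite !(sq v) //; congr [&& _, _ & _]; apply: eq_forallb => y.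
rewrite !(@adj_formE n G) // eval_fst // eval_snd //.
rewrite !(sp (upd v 7 y)); last first.
  by move=> z; rewrite !inE !negb_or => /and3P[_ _ z7]; rewrite updNe.
by rewrite /= upd_eq updNe.
Qed.
Local Opaque block_form.

Lemma block_size_exprE S v p q P Q : static G S ->
  stable S v p P -> stable S v q Q ->
  eval B S (block_size_expr p q) v = block_size P Q.
Proof.
have st4 e E a : stable S v e E -> stable S (upd v 4 a) e E.
  move=> h v' hv; apply: h => y hy; rewrite hv // updNe //.
  by move: hy; rewrite !inE !negb_or => /and3P[].
have st5 e E a b : stable S v e E -> stable S (upd (upd v 4 a) 5 b) e E.
  move=> h v' hv; apply: h => y hy; rewrite hv // !updNe //;
  by move: hy; rewrite !inE !negb_or => /and3P[].
move=> st sp sq; rewrite /block_size_expr /block_size.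
have -> : block_clique P Q = holds B S (Fall 4 (Fall 5
    (For_ (Fnot (Fand (block_form p q 4) (block_form p q 5)))
          (adj_form (Var 4) (Var 5))))) v.
  rewrite [RHS]/=; apply: eq_forallb => x; apply: eq_forallb => y.
  rewrite (@adj_formE n G) // !(@block_formE _ _ _ _ _ P Q) //;
    by [rewrite /= /upd | apply: st5].
rewrite /=; case: ifP => // _; apply: eq_bigr => x _.
by rewrite (@block_formE _ _ _ _ _ P Q) //; apply: st4.
Qed.
Local Opaque block_size_expr.

Lemma touch_formE S v a b : static G S ->
  holds B S (touch_form a b) v = touch (eval B S a v) (eval B S b v).
Proof.
move=> st; rewrite /touch_form [LHS]/= !(@adj_formE n G) //.
by rewrite !eval_fst // !eval_snd.
Qed.
Local Opaque touch_form.

Definition best_block (p : nat) : nat :=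
  first B (fun q => [forall q' : 'I_B, ~~ (block_size p q < block_size p q')]).

Lemma best_blockP p : p < B -> best_block p < B /\
  forall q, q < B -> block_size p q <= block_size p (best_block p).
Proof.
move=> pB; rewrite /best_block; set phi := fun q => _.
case: (firstP B phi) => [[h /forallP h2]|[_ none]].
  by split=> // q qB; have := h2 (Ordinal qB); rewrite -leqNgt.
case: (@arg_maxnP _ (Ordinal pB) xpredT (fun q => block_size p (val q)) isT) =>
  q _ maxq.
case/negP: (none q (ltn_ord q)); apply/forallP => q'.
by rewrite -leqNgt; apply: maxq.
Qed.

Lemma best_block_exprE S v p : static G S ->
  eval B S best_block_expr (upd v 6 p) = best_block p.
Proof.
move=> st; rewrite /best_block_expr [LHS]/=; apply: eq_bigr => k _.
congr (if _ then _ else _); apply: eq_existsb => j; congr (_ && _).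
apply: eq_forallb => q.
rewrite (@block_size_exprE S _ _ _ p j) // ?(@block_size_exprE S _ _ _ p q) //.
- by move=> v' hv; rewrite /= hv.
- by move=> v' hv; rewrite /= hv.
- by move=> v' hv; rewrite /= hv.
by move=> v' hv; rewrite /= hv.
Qed.
Local Opaque best_block_expr.

Definition weight (p : nat) : nat :=
  if adjn G (fst_vertex p) (snd_vertex p) then block_size p (best_block p)
    else 0.

Lemma ltn_sqr (x : 'I_n) : x < B.
Proof. exact: leq_trans (ltn_ord x) (leq_sqr n). Qed.

Lemma block_covered p q x y : block p q x -> adjn G x y ->
  adjn G y (fst_vertex p) || adjn G y (snd_vertex p).
Proof.
move=> /and3P[_ _ /forallP h] xy; have [_ yn] := adjn_lt xy.
have yB := leq_trans yn (leq_sqr n).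
by have := h (Ordinal yB); rewrite /= xy.
Qed.

Lemma block_lt p q x : block p q x -> x < n.
Proof. by case/and3P => /adjn_lt[]. Qed.

Lemma touch_sym p q : touch p q = touch q p.
Proof.
rewrite /touch !(adjn_sym _ (fst_vertex p)) !(adjn_sym _ (snd_vertex p)).
by do 4!case: adjn.
Qed.

Lemma weight_adj p : 0 < weight p -> adjn G (fst_vertex p) (snd_vertex p).
Proof. by rewrite /weight; case: adjn. Qed.

Lemma weight_clique p : 0 < weight p ->
  block_clique p (best_block p) /\ weight p = \sum_(x < B)
    block p (best_block p) x.
Proof. by rewrite /weight /block_size; case: adjn => //;
  case: block_clique. Qed.

Lemma touch_refl p : 0 < weight p -> touch p p.
Proof. by move/weight_adj => h; rewrite /touch h orbT. Qed.

(** A pair of positive weight is adjacent, so it spans an interval. Take the pair whose span ends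
    first: every pair in [A] touching it spans its last point, hence any two of them touch. *)
Lemma touch_simplicial (A : pred nat) :
  (forall x, x < B -> A x -> 0 < weight x) -> (exists2 x, x < B & A x) ->
  exists p, [/\ p < B, A p & forall q q', q < B -> q' < B ->
    A q -> A q' -> touch p q -> touch p q' -> touch q q'].
Proof.
move=> Aw [p0 p0B Ap0].
pose L a := if insub a is Some x then l x else 0.
pose R a := if insub a is Some x then r x else 0.
have adjE a b : a < n -> b < n -> adjn G a b = (L a < R b) && (L b < R a).
  move=> an bn; rewrite -[a]/(val (Ordinal an)) -[b]/(val (Ordinal bn)).
  by rewrite adjnE model /L /R !valK.
have LR a : a < n -> L a < R a.
  by move=> an; rewrite -[a]/(val (Ordinal an)) /L /R !valK.
pose R2 p := maxn (R (fst_vertex p)) (R (snd_vertex p)).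
case: (@arg_minnP _ (Ordinal p0B) (fun p => A (val p)) (fun p =>
  R2 (val p)) Ap0) => p Ap minp.
exists p; split=> // q q' qB q'B Aq Aq'.
have := minp (Ordinal q'B) Aq'; have := minp (Ordinal qB) Aq.
have := weight_adj (Aw _ (ltn_ord p) Ap).
have := weight_adj (Aw _ qB Aq); have := weight_adj (Aw _ q'B Aq').
rewrite /R2 /touch /=; move: (fst_vertex p) (snd_vertex p) => a b.
move: (fst_vertex q) (snd_vertex q) => c d.
move: (fst_vertex q') (snd_vertex q') => e f ef cd ab.
have [an bn] := adjn_lt ab; have [cn dn] := adjn_lt cd;
  have [en fn] := adjn_lt ef.
move: ef cd ab; rewrite !adjE //.
move: (LR a an) (LR b bn) (LR c cn) (LR d dn) (LR e en) (LR f fn).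
by rewrite !geq_max !leq_max; lia.
Qed.

Section Solution.
Variable I : pred nat.
Hypothesis maxI : max_indep B touch weight I.

Definition kept : {set 'I_n} :=
  [set x : 'I_n | [exists p : 'I_B, I p && block p (best_block p) x]].

(** Coverage of [x] makes [y] a neighbour of a vertex of [p]; coverage of [y] then makes that vertex
    a neighbour of a vertex of [q]. So [p] and [q] touch, and independence forces them to be
    equal. *)
Lemma block_unique (p q : 'I_B) x y : I p -> I q ->
  block p (best_block p) x -> block q (best_block q) y -> adjn G x y -> p = q.
Proof.
move=> Ip Iq px qy xy; have [_ inI _] := maxI.
apply/eqP/negPn/negP => pq.
case/negP: (inI p q (ltn_ord p) (ltn_ord q) Ip Iq pq).
rewrite /touch; case/orP: (block_covered px xy) => h.
  by case/orP: (block_covered qy h) => ->; rewrite ?orbT.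
by case/orP: (block_covered qy h) => ->; rewrite ?orbT.
Qed.

Lemma kept_cluster (x y z : 'I_n) : x \in kept -> y \in kept -> z \in kept ->
  adjc G x y -> adjc G y z -> adjc G x z.
Proof.
rewrite !inE -!adjnE => /existsP[p /andP[Ip px]] /existsP[q /andP[Iq qy]].
move=> /existsP[s /andP[Is sz]] xy yz.
have epq := block_unique Ip Iq px qy xy.
have eqs := block_unique Iq Is qy sz yz.
rewrite -eqs -epq in sz.
have [pos _ _] := maxI; have [/forallP cl _] :=
  weight_clique (pos p (ltn_ord p) Ip).
have := forallP (cl (Ordinal (ltn_sqr x))) (Ordinal (ltn_sqr z)).
by rewrite /= px sz.
Qed.

(** After exchanging the sums, each kept vertex counts at most once, because by [block_unique] it
    lies in only one chosen block. *)
Lemma card_kept : \sum_(p < B | I p) weight p <= #|kept|.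
Proof.
have [pos _ _] := maxI.
have -> : \sum_(p < B | I p) weight p =
   \sum_(p < B | I p) \sum_(x < n) block p (best_block p) x.
  apply: eq_bigr => p Ip; have [_ ->] := weight_clique (pos p (ltn_ord p) Ip).
  rewrite sum_ord_sqr => [|x]; last exact: block_lt.
  by rewrite -sum1dep_card big_mkcond; apply: eq_bigr => x _; case: block.
rewrite exchange_big /= -sum1_card [X in _ <= X]big_mkcond /=.
apply: leq_sum => x _; case: ifP => xK; last first.
  rewrite big1 // => p Ip; case px: block => //.
  by move: xK; rewrite inE => /existsP[]; exists p; rewrite Ip px.
rewrite (eq_bigr (fun p : 'I_B => if block p (best_block p) x then 1 else 0))
  => [|p _].
  rewrite -big_mkcondr sum1_card; apply/card_le1_eqP => p q.
  rewrite !unfold_in => /andP[Ip px] /andP[Iq qx].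
  apply: block_unique qx px _ => //; apply: adjn_refl; exact: ltn_ord.
by case: block.
Qed.

(** The pairs from [cluster_optimal] are independent for [touch], and each class [F p] has at most
    [weight p] members; so the weight of [I], hence the size of [kept], is at least the size of
    [K]. *)
Lemma kept_optimal (K : {set 'I_n}) :
  (forall x y z, x \in K -> y \in K -> z \in K ->
     adjc G x y -> adjc G y z -> adjc G x z) -> #|K| <= #|kept|.
Proof.
move=> trK; have [|J [F [Jadj Jin JF le]]] := @cluster_optimal _ l r lr K.
  by move=> x y z xK yK zK; rewrite -!model; apply: trK.
have [_ _ opt] := maxI.
have idxB (p : 'I_n * 'I_n) : p.1 * n + p.2 < B by have [] :=
  pair_index p.1 p.2.
pose idx p := Ordinal (idxB p).
have fstE p : fst_vertex (idx p) = p.1.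
  by rewrite /fst_vertex ltn_ord; have [] := pair_index p.1 p.2.
have sndE p : snd_vertex (idx p) = p.2.
  by rewrite /snd_vertex ltn_ord; have [] := pair_index p.1 p.2.
have idx_inj : injective idx.
  move=> [a b] [c d] e; have := fstE (a, b); have := sndE (a, b).
  by rewrite e fstE sndE /= => /val_inj-> /val_inj->.
have touchE p q : touch (idx p) (idx q) = touches l r p q.
  by rewrite /touch /touches !fstE !sndE !adjnE !model.
have J0 : indep B touch (members (idx @: J)).
  move=> x y xB yB; rewrite -[x]/(val (Ordinal xB)) -[y]/(val (Ordinal yB))
    !membersE.
  move=> /imsetP[p pJ ->] /imsetP[q qJ ->] pq; rewrite touchE; apply: Jin => //.
  by apply: contra pq => /eqP->.
apply: leq_trans le _; apply: leq_trans (leq_trans (opt _ J0) card_kept).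
rewrite (eq_bigl (fun x => x \in idx @: J)) => [|x]; last by rewrite membersE.
rewrite big_imset /=; last by move=> p q _ _; apply: idx_inj.
apply: leq_sum => p pJ.
have [F0 clF Fcov] := JF p pJ.
(* The vertices covered by [p]. The class [F p] is a clique among them, so it extends to a clique
   that is a block. *)
pose S := [set x : 'I_n | [forall y : 'I_B, ~~ adjn G x y ||
      (adjn G y (fst_vertex (idx p)) || adjn G y (snd_vertex (idx p)))]].
have FS : F p \subset S.
  apply/subsetP => x xF; rewrite inE; apply/forallP => y.
  rewrite -implybE; apply/implyP => xy; have [_ yn] := adjn_lt xy.
  move: xy; rewrite -[val y]/(val (Ordinal yn)) fstE sndE !adjnE !model.
  exact: Fcov.
have [u [v [FD clD]]] := maximal_clique_pair lr FS F0 clF.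
set D := [set x in S | _] in FD clD.
have blockE (x : 'I_n) : block (idx p) (idx (u, v)) x = (x \in D).
  by rewrite /block (fstE (u, v)) (sndE (u, v))
    !adjnE !model andbA andbC inE [x \in S]inE.
have bc : block_clique (idx p) (idx (u, v)).
  apply/forallP => x; apply/forallP => y; rewrite -implybE;
    apply/implyP => /andP[bx b2].
  have xn := block_lt bx; have yn := block_lt b2; move: bx b2.
  rewrite -[val x]/(val (Ordinal xn)) -[val y]/(val (Ordinal yn))
    !blockE adjnE model.
  exact: clD.
rewrite /weight fstE sndE adjnE model Jadj //.
have [_ /(_ (idx (u, v)) (ltn_ord _))] := best_blockP (ltn_ord (idx p)).
apply: leq_trans; rewrite /block_size bc sum_ord_sqr => [|x];
  last exact: block_lt.
by apply: leq_trans (subset_leq_card FD) _; apply: subset_leq_card;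
  apply/subsetP => x; rewrite [in X in _ -> X]inE blockE.
Qed.

End Solution.

Lemma cluster_cmd_correct :
  exists2 X, min_deletion_set cluster_graph G X &
    forall x : 'I_n,
      (run B cluster_cmd (fun=> B) (initial (encode_graph G)) 0 x != 0)
        = (x \in X).
Proof.
pose u (_ : nat) := B.
pose S1 := run B (Map 9 6 best_block_expr) u (decoded G).
pose S2 := run B (Map 6 6 (Ite (adj_form (Get 3 (Var 6)) (Get 4 (Var 6)))
                    (block_size_expr (Var 6) (Get 9 (Var 6))) (Num 0))) u S1.
have st1 : static G S1 by apply: static_Map.
have st2 : static G S2 by apply: static_Map.
have S19 p : S1 9 p = best_block p.
  by apply: best_block_exprE.
have S26 p : p < B -> S2 6 p = weight p.
  move=> pB; rewrite /S2 [LHS]/= (@adj_formE n G) // eval_fst // eval_snd //.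
  rewrite /weight [eval _ _ _ _]upd_eq (@block_size_exprE _ _ _ _ p (best_block
    p)) //.
    by move=> v' hv; rewrite /= hv.
  by move=> v' hv; rewrite /= hv //= upd_eq pB S19.
have [] := @mwis_correct touch_form B touch S2 _ u erefl.
  move=> S' v a b sb; apply: touch_formE; exact: static_same_but sb st2.
set S3 := run B _ u S2; set I := chosen _ _ _ _ => sb3 S38.
have st3 : static G S3 by apply: static_same_but sb3 st2.
have wle : forall x, x < B -> 0 < S2 6 x -> 0 < weight x.
  by move=> x xB; rewrite S26.
have mx2 : max_indep B touch (S2 6) I.
  apply: chosen_max_indep.
  - by move=> x y _ _ _ _; apply: touch_sym.
  - by move=> x xB /wle; move/(_ xB); apply: touch_refl.
  - by move=> A Aw; apply: touch_simplicial => x xB /(Aw x xB); apply: wle.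
have sumE (J : pred nat) : \sum_(x < B | J x) S2 6 x = \sum_(x < B | J x)
  weight x.
  by apply: eq_bigr => x _; rewrite S26.
have mxI : max_indep B touch weight I.
  case: mx2 => h1 h2 h3; split=> //.
    by move=> x xB Ix; apply: wle => //; apply: h1.
  by move=> J Jin; rewrite -!sumE; apply: h3.
exists (~: kept I).
  split.
    apply/cluster_deleteE => x y z; rewrite !inE !negbK => xK yK zK.
    by apply: (kept_cluster mxI); rewrite inE.
  move=> Y /cluster_deleteE trY; apply: card_setC_le; rewrite setCK.
  by apply: kept_optimal => // x y z; rewrite !inE; apply: trY.
move=> x.
have [_ e] := run_Tab B 6 (Ite (Fex 3 (Fand (pos 8 3)
   (block_form (Var 3) (Get 9 (Var 3)) 6))) (Num 0) (Num 1))
     u S3 (isT : 0 != 5).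
rewrite -[run _ _ _ _ 0 x]/(run B (Tab 0 6 (Ite (Fex 3 (Fand (pos 8 3)
   (block_form (Var 3) (Get 9 (Var 3)) 6))) (Num 0) (Num 1))) u S3 0 x).
rewrite e ?ltn_sqr // [eval _ _ _ _]/= !inE.
have -> : [exists k : 'I_B, (0 < (if upd (upd u 6 x)
  3 k 3 < B then S3 8 (upd (upd u 6 x) 3 k 3) else 0))
   && holds B S3 (block_form (Var 3) (Get 9 (Var 3)) 6) (upd (upd u 6 x) 3 k)]
   = [exists p : 'I_B, I p && block p (best_block p) x].
  apply: eq_existsb => p; rewrite upd_eq ltn_ord S38 // lt0b.
  rewrite (@block_formE S3 _ _ _ _ p (best_block p)) //.
    by move=> v' hv; rewrite /= hv.
  by move=> v' hv; rewrite /= hv //= upd_eq ltn_ord sb3 //; apply: S19.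
by case: [exists p, _].
Qed.

End ClusterCorrect.

Theorem theorem4 (R : realType) :
  poly_time_solvable (fun V => @interval_graph V R)
    (@min_deletion_set complete_split_graph)
  /\
  poly_time_solvable (fun V => @interval_graph V R)
    (@min_deletion_set cluster_graph).
Proof.
split.
  apply: poly_time_by_cmd split_cmd_wf _ => n G /interval_model[l [r [lr
    model]]].
  exact: split_cmd_correct lr model.
apply: poly_time_by_cmd cluster_cmd_wf _ => n G /interval_model[l [r [lr
  model]]].
exact: cluster_cmd_correct lr model.
Qed.
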